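(* Let $0<\beta<\alpha<\mu\le1$, let $k$ satisfy the kernel regularity assumption with exponent $\mu$ given in the context, and let $\lambda\in\mathbb C$ satisfy $\ker(I-\lambda K)=\{0\}$ in $X_\beta$. Let $A=I-\lambda K$, $f\in X_\alpha$, and let $$J_f=\sum_{j=1}^{n_d}[f]_{t_j^d}G_j,\qquad f_C=f-J_f\in H_\alpha(\Gamma),\qquad g:=f_C+\lambda KJ_f .$$ Then the equations $$A\varphi=f\qquad\text{and}\qquad Au=g$$ are equivalent under the transformation $\varphi=u+J_f$. The reduced equation $Au=g$ has a unique solution $u\in H_\alpha(\Gamma)$, and $$\|u\|_{H_\alpha(\Gamma)}\le C\|f\|_{X_\alpha}$$ with a constant $C$ independent of $f$.
   Context: **Contour.** $\Gamma\subset\mathbb C$ is a simple, closed, positively oriented contour of class $C^2$ with a regular $C^2$, $2\pi$-periodic parametrization $\gamma:\mathbb R\to\Gamma$ (so $\gamma(\theta+2\pi)=\gamma(\theta)$, $\gamma'(\theta)\ne0$, $\gamma$ injective on $[0,2\pi)$). $\mathcal D=\{t_1^d,\ldots,t_{n_d}^d\}\subset\Gamma$, $n_d\ge1$, is a set of distinct points, $t_j^d=\gamma(\theta_j^d)$ with $0<\theta_1^d<\cdots<\theta_{n_d}^d<2\pi$; the point $t_*=\gamma(0)=\gamma(2\pi)\notin\mathcal D$ is the cut. The continuity arcs are the $n_d$ open arcs of $\Gamma\setminus\mathcal D$. For a function $v$ with one-sided limits, $v(t_j^d\pm0)$ denote the limits along the orientation ($-$: incoming, $+$: outgoing), $[v]_{t_j^d}:=v(t_j^d+0)-v(t_j^d-0)$,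 and functions are represented by incoming values $v(t_j^d)=v(t_j^d-0)$. **Spaces.** For $0<\sigma<1$, $X_\sigma=PH_\sigma(\Gamma,\mathcal D)$ is the space of complex functions that are $\sigma$-Hölder on every continuity arc and have finite lateral limits at all points of $\mathcal D$, with norm $\|v\|_{X_\sigma}=\max_I(\|v\|_{\infty,I}+[v]_{\sigma,I})$, the maximum over the continuity arcs $I$; here $\overline I^{\,\ell}$ is $I$ completed by its two endpoints carrying the lateral values, $\|v\|_{\infty,I}=\sup_{\overline I^{\,\ell}}|v|$ and $[v]_{\sigma,I}=\sup_{t\ne s\in\overline I^{\,\ell}}|v(t)-v(s)|/|t-s|^\sigma$. If $n_d=1$, the distance $|t-s|$ in this seminorm is understood as the distance along the (single) completed arc. $H_\sigma(\Gamma)$ ($0<\sigma\le1$) is the space of globally $\sigma$-Hölder (Lipschitz if $\sigma=1$) functions on $\Gamma$ with norm $\sup_\Gamma|v|+\sup_{t\ne s\in\Gamma}|v(t)-v(s)|/|t-s|^\sigma$. **Kernel regularity assumption.** There are constants $M_0,M_\mu$ with $|k(t,\tau)|\le M_0$ and $|k(t,\tau)-k(s,\tau)|\le M_\mu|t-s|^\mu$ for all $t,s,\tau\in\Gamma$, and a modulus of continuity $\omega_k$ with $\omega_k(r)\to0$ as $r\downarrow0$ such that $|k(t,\tau)-k(t,\zeta)|\le\omega_k(|\tau-\zeta|)$ for all $t,\tau,\zeta\in\Gamma$. **Operator.** $(Kv)(t)=\int_\Gamma k(t,\tau)v(\tau)\,d\tau$ (complex contour integral). Solutions $\varphi$, $u$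 of $A\varphi=f$, $Au=g$ are sought in $X_\beta$ and globally continuous (Hölder) functions, respectively. **Generators.** For $0\le\theta<2\pi$: $H_j(\gamma(\theta))=0$ if $0\le\theta\le\theta_j^d$ and $=1$ if $\theta_j^d<\theta<2\pi$; $R(\gamma(\theta))=\theta/(2\pi)$; $G_j:=H_j-R$. *)

(* Defs.v *)
From Stdlib Require Import Reals List Arith ClassicalEpsilon.
From Coquelicot Require Import Coquelicot.

Open Scope R_scope.

(* Functions on Gamma are total functions [C -> C] of which only the values on
   Gamma matter: memberships, equations and norms below never look outside. *)

Definition on_curve (gam : R -> C) (t : C) : Prop := exists th : R, gam th = t.

Definition eq_on (D : C -> Prop) (v w : C -> C) : Prop :=
  forall t, D t -> v t = w t.

Definition C2 (f : R -> R) : Prop :=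
  (forall m x, (m <= 2)%nat -> ex_derive_n f m x) /\
  (forall x, continuous (Derive_n f 2) x).

Definition dgam (gam : R -> C) (th : R) : C :=
  (Derive (fun x => Re (gam x)) th, Derive (fun x => Im (gam x)) th).

(* The complex contour integral of F(tau) dtau. *)
Definition cint (gam : R -> C) (F : C -> C) : C :=
  RInt (V := C_R_CompleteNormedModule)
    (fun th => (F (gam th) * dgam gam th)%C) 0 (2 * PI).

Definition winding (gam : R -> C) (z : C) : C :=
  (cint gam (fun tau => / (tau - z)) / (2 * PI * Ci))%C.

(* Points of the complement whose path component in the complement is bounded. *)
Definition inside (gam : R -> C) (z : C) : Prop :=
  ~ on_curve gam z /\
  exists M : R, forall p : R -> C,
    (forall s, continuous p s) -> p 0 = z ->
    (forall s, 0 <= s <= 1 -> ~ on_curve gam (p s)) ->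
    Cmod (p 1) <= M.

Record is_contour (gam : R -> C) : Prop := {
  contour_C2_re : C2 (fun th => Re (gam th));
  contour_C2_im : C2 (fun th => Im (gam th));
  contour_periodic : forall th, gam (th + 2 * PI) = gam th;
  contour_regular : forall th, dgam gam th <> RtoC 0;
  contour_simple : forall th th', 0 <= th < 2 * PI -> 0 <= th' < 2 * PI ->
    gam th = gam th' -> th = th';
  contour_positive : forall z, inside gam z -> winding gam z = RtoC 1
}.

(* The parameters theta_1 < ... < theta_nd are indexed by 1, ..., nd; the other
   values of [thd] are never used. *)
Record is_disc (nd : nat) (thd : nat -> R) : Prop := {
  disc_nonempty : (1 <= nd)%nat;
  disc_first : 0 < thd 1%nat;
  disc_incr : forall j, (1 <= j < nd)%nat -> thd j < thd (S j);
  disc_last : thd nd < 2 * PI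
}.

Definition lat_right (gam : R -> C) (v : C -> C) (th : R) : C :=
  iota (T := C_R_CompleteNormedModule)
    (fun l => filterlim (fun x => v (gam x)) (at_right th) (locally l)).

Definition lat_left (gam : R -> C) (v : C -> C) (th : R) : C :=
  iota (T := C_R_CompleteNormedModule)
    (fun l => filterlim (fun x => v (gam x)) (at_left th) (locally l)).

Definition jump (gam : R -> C) (v : C -> C) (th : R) : C :=
  (lat_right gam v th - lat_left gam v th)%C.

(* The j-th continuity arc is gam ((arc_l j, arc_r j)), 1 <= j <= nd; the last
   one passes through the cut gam 0 = gam (2 PI). *)
Definition arc_l (thd : nat -> R) (j : nat) : R := thd j.

Definition arc_r (nd : nat) (thd : nat -> R) (j : nat) : R :=
  if Nat.ltb j nd then thd (S j) else thd 1%nat + 2 * PI.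

(* |t - s| for points of a common completed arc, given by their parameters in
   [arc_l j, arc_r j].  When nd = 1 the two endpoints of the only completed arc
   project to the same point, and the length along the arc is used instead. *)
Definition arc_dist (gam : R -> C) (nd : nat) (x y : R) : R :=
  if Nat.eqb nd 1 then Rabs (RInt (fun th => Cmod (dgam gam th)) x y)
  else Cmod (gam x - gam y).

Record in_X (gam : R -> C) (nd : nat) (thd : nat -> R) (s : R) (v : C -> C)
  : Prop := {
  X_holder : forall j, (1 <= j <= nd)%nat -> exists M : R, forall x y,
    arc_l thd j < x < arc_r nd thd j -> arc_l thd j < y < arc_r nd thd j ->
    x <> y ->
    Cmod (v (gam x) - v (gam y)) <= M * Rpower (arc_dist gam nd x y) s;
  X_right : forall j, (1 <= j <= nd)%nat -> exists l : C,
    filterlim (fun x => v (gam x)) (at_right (thd j)) (locally l);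
  (* functions are represented by their incoming values *)
  X_left : forall j, (1 <= j <= nd)%nat ->
    filterlim (fun x => v (gam x)) (at_left (thd j))
      (locally (v (gam (thd j))))
}.

(* v on the completed arc, with the lateral values at the two endpoints. *)
Definition arc_val (gam : R -> C) (nd : nat) (thd : nat -> R) (v : C -> C)
    (j : nat) (x : R) : C :=
  if Req_EM_T x (arc_l thd j) then lat_right gam v x
  else if Req_EM_T x (arc_r nd thd j) then lat_left gam v x
  else v (gam x).

(* Only used for nonempty bounded sets. *)
Definition rsup (E : R -> Prop) : R := real (Lub_Rbar E).

Definition arc_sup (gam : R -> C) (nd : nat) (thd : nat -> R) (v : C -> C)
    (j : nat) : R :=
  rsup (fun r => exists x, arc_l thd j <= x <= arc_r nd thd j /\
    r = Cmod (arc_val gam nd thd v j x)).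

Definition arc_semi (gam : R -> C) (nd : nat) (thd : nat -> R) (s : R)
    (v : C -> C) (j : nat) : R :=
  rsup (fun r => exists x y,
    arc_l thd j <= x <= arc_r nd thd j /\
    arc_l thd j <= y <= arc_r nd thd j /\ x <> y /\
    r = Cmod (arc_val gam nd thd v j x - arc_val gam nd thd v j y)
        / Rpower (arc_dist gam nd x y) s).

Definition norm_X (gam : R -> C) (nd : nat) (thd : nat -> R) (s : R)
    (v : C -> C) : R :=
  fold_right Rmax 0
    (map (fun j => arc_sup gam nd thd v j + arc_semi gam nd thd s v j)
       (seq 1 nd)).

(* The condition t <> r avoids [Rpower 0 s], which is not 0. *)
Definition in_H (gam : R -> C) (s : R) (v : C -> C) : Prop :=
  exists M : R, forall t r, on_curve gam t -> on_curve gam r -> t <> r ->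
    Cmod (v t - v r) <= M * Rpower (Cmod (t - r)) s.

Definition norm_H (gam : R -> C) (s : R) (v : C -> C) : R :=
  rsup (fun r => exists t, on_curve gam t /\ r = Cmod (v t)) +
  rsup (fun r => exists t t', on_curve gam t /\ on_curve gam t' /\ t <> t' /\
    r = Cmod (v t - v t') / Rpower (Cmod (t - t')) s).

Definition kernel_regular (gam : R -> C) (mu : R) (k : C -> C -> C) : Prop :=
  exists (M0 Mmu : R) (omega : R -> R),
    (forall t tau, on_curve gam t -> on_curve gam tau ->
       Cmod (k t tau) <= M0) /\
    (forall t s tau, on_curve gam t -> on_curve gam s -> on_curve gam tau ->
       t <> s ->
       Cmod (k t tau - k s tau) <= Mmu * Rpower (Cmod (t - s)) mu) /\
    filterlim omega (at_right 0) (locally 0) /\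
    (forall t tau zeta, on_curve gam t -> on_curve gam tau ->
       on_curve gam zeta ->
       Cmod (k t tau - k t zeta) <= omega (Cmod (tau - zeta))).

Definition Kop (gam : R -> C) (k : C -> C -> C) (v : C -> C) (t : C) : C :=
  cint gam (fun tau => (k t tau * v tau)%C).

Definition Aop (gam : R -> C) (k : C -> C -> C) (lam : C) (v : C -> C) (t : C)
  : C := (v t - lam * Kop gam k v t)%C.

(* For t on Gamma, the unique th in [0, 2 PI) with gam th = t. *)
Definition param (gam : R -> C) (t : C) : R :=
  epsilon (inhabits 0) (fun th => 0 <= th < 2 * PI /\ gam th = t).

Definition Hgen (gam : R -> C) (thd : nat -> R) (j : nat) (t : C) : R :=
  if Rle_dec (param gam t) (thd j) then 0 else 1.

Definition Rgen (gam : R -> C) (t : C) : R := param gam t / (2 * PI).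

Definition Ggen (gam : R -> C) (thd : nat -> R) (j : nat) (t : C) : R :=
  Hgen gam thd j t - Rgen gam t.

Definition Jpart (gam : R -> C) (nd : nat) (thd : nat -> R) (f : C -> C)
    (t : C) : C :=
  sum_n_m (fun j => (jump gam f (thd j) * Ggen gam thd j t)%C) 1 nd.

Definition fC (gam : R -> C) (nd : nat) (thd : nat -> R) (f : C -> C) (t : C)
  : C := (f t - Jpart gam nd thd f t)%C.

Definition gred (gam : R -> C) (nd : nat) (thd : nat -> R) (k : C -> C -> C)
    (lam : C) (f : C -> C) (t : C) : C :=
  (fC gam nd thd f t + lam * Kop gam k (Jpart gam nd thd f) t)%C.

(* Main.v *)
Require Import Defs.
From Stdlib Require Import Reals ZArith Lra Lia List FinFun.
From Stdlib Require Import Classical ClassicalEpsilon FunctionalExtensionality.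
From Coquelicot Require Import Coquelicot.
Open Scope R_scope.

(* Since K maps bounded integrable functions into H_mu, every solution is as
   regular as the right-hand side.  Subtracting J_f cancels the jumps of f: in
   the parameter, f_C is Hölder on each completed arc and continuous at its
   ends, hence Hölder on a whole period by gluing, and hence on Gamma by the
   chord-arc inequality.

   Solvability of u - lam K u = g is a Fredholm alternative on the functions v
   with v o gam continuous.  Replacing k(t, tau) by k(t, tau_i) for tau in the
   i-th of n short arcs splits lam K into a finite-rank operator, whose range is
   spanned by the sections k(., tau_i), and an operator S of norm at most 1/2.
   The Neumann series inverts I - S, and what remains is a square linear system,
   which is solvable because it is injective.  A continuous null vector of
   I - lam K lies in H_mu, so in X_beta, and vanishes by hypothesis. *)

(** The kernel is Hölder in [t] but only uniformly continuous in [tau]. Continuity in [tau], uniform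
    in [t], is what makes the splitting small, so the Fredholm alternative rests on a geometric
    series and elimination instead of a compactness theorem for operators. The sup norm suffices
    there: the identity u = f_C + lam K J_f + lam K u turns a sup bound on u into a Hölder bound.
    The constant is independent of f because a general right-hand side reduces to finitely many
    fixed solutions, one for each section k(., tau_i). Two obstacles shape the rest. A function in
    X_beta is known only arc by arc, while linearity of K needs integrability over the whole curve;
    the decomposition v = (v - J_v) + J_v, used at the exponent beta, supplies it. And distances on
    an arc, on Gamma and in the parameter differ, with arc length in place of the chord for a single
    arc; Hölder estimates are therefore made in the parameter, where arcs are intervals, and
    converted at both ends. *)

(** * Complex modulus, limits and continuity *)

Lemma im_le_Cmod (z : C) : Rabs (Im z) <= Cmod z.
Proof. exact (Rle_trans _ _ _ (Rmax_r _ _) (Rmax_Cmod z)). Qed.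

Lemma Cmod_le_abs_sum (z : C) : Cmod z <= Rabs (Re z) + Rabs (Im z).
Proof.
  destruct z as [a b]; cbn [Re Im fst snd].
  replace ((a, b) : C) with (RtoC a + (0, b))%C
    by (unfold Cplus, RtoC; simpl; f_equal; ring).
  eapply Rle_trans; [apply Cmod_triangle|].
  rewrite Cmod_R. apply Rplus_le_compat_l.
  right. unfold Cmod; simpl.
  replace (0 * (0 * 1) + b * (b * 1)) with (Rsqr b) by (unfold Rsqr; ring).
  apply sqrt_Rsqr_abs.
Qed.

Lemma Cmod_minus_sym (a b : C) : Cmod (a - b) = Cmod (b - a).
Proof. rewrite <- Cmod_opp. f_equal. ring. Qed.

Lemma Cmod_minus_triangle (a b c : C) : Cmod (a - c) <= Cmod (a - b) + Cmod (b - c).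
Proof. replace (a - c)%C with ((a - b) + (b - c))%C by ring. apply Cmod_triangle. Qed.

Lemma Cminus_plus_plus (a b c d : C) : (a + b - (c + d) = (a - c) + (b - d))%C.
Proof. ring. Qed.

Lemma Cminus_minus_minus (a b c d : C) : (a - b - (c - d) = (a - c) - (b - d))%C.
Proof. ring. Qed.

Lemma Cmod_minus_le (a b : C) : Cmod (a - b) <= Cmod a + Cmod b.
Proof. rewrite <- (Cmod_opp b). apply Cmod_triangle. Qed.

Lemma Cmod_zero_of_small (z : C) : (forall eps, 0 < eps -> Cmod z <= eps) -> z = RtoC 0.
Proof.
  intros H. apply Cmod_eq_0. apply Rle_antisym; [|apply Cmod_ge_0].
  apply le_epsilon. intros e He. rewrite Rplus_0_l. now apply H.
Qed.

(** The balls of [C_UniformSpace] are squares, hence the [eps / 2] for each coordinate; from here on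
    limits are handled with the modulus. *)
Lemma filterlim_Cmod {T : Type} {F : (T -> Prop) -> Prop} {FF : Filter F}
  (f : T -> C) (l : C) :
  filterlim f F (locally (T := C_UniformSpace) l) <->
  (forall eps, 0 < eps -> F (fun x => Cmod (f x - l) < eps)).
Proof.
  split.
  - intros H eps He.
    assert (He2 : 0 < eps / 2) by lra.
    generalize (proj1 (filterlim_locally f l) H (mkposreal _ He2)).
    apply filter_imp. intros x [H1 H2].
    eapply Rle_lt_trans; [apply Cmod_le_abs_sum|].
    change (Rabs (fst (f x) - fst l) < eps / 2) in H1.
    change (Rabs (snd (f x) - snd l) < eps / 2) in H2.
    unfold Re, Im; simpl.
    unfold Rminus in *. lra.
  - intros H. apply (filterlim_locally f l). intros eps.
    generalize (H eps (cond_pos eps)). apply filter_imp. intros x Hx.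
    split.
    + eapply Rle_lt_trans; [|exact Hx]. apply (re_le_Cmod (f x - l)).
    + eapply Rle_lt_trans; [|exact Hx]. apply (im_le_Cmod (f x - l)).
Qed.

Lemma continuous_Cmod (f : R -> C) (x : R) :
  continuous (U := C_UniformSpace) f x <->
  (forall eps, 0 < eps -> exists d, 0 < d /\
     forall y, Rabs (y - x) < d -> Cmod (f y - f x) < eps).
Proof.
  unfold continuous. rewrite filterlim_Cmod. split; intros H eps He.
  - destruct (H eps He) as [d Hd]. exists d. split; [apply cond_pos|].
    intros y Hy. apply Hd. exact Hy.
  - destruct (H eps He) as [d [Hd Hy]]. exists (mkposreal d Hd).
    intros y Hyd. apply Hy. exact Hyd.
Qed.

Lemma continuous_C_iff (f : R -> C) (x : R) :
  continuous (U := C_UniformSpace) f x <->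
  continuous (fun y => Re (f y)) x /\ continuous (fun y => Im (f y)) x.
Proof.
  split.
  - intros H. split; apply (filterlim_locally (U := R_UniformSpace));
      intros eps; destruct (proj1 (continuous_Cmod f x) H eps (cond_pos eps))
        as [d [Hd Hy]]; exists (mkposreal d Hd); intros y Hyd;
      (eapply Rle_lt_trans; [|exact (Hy y Hyd)]).
    + apply (re_le_Cmod (f y - f x)).
    + apply (im_le_Cmod (f y - f x)).
  - intros [H1 H2]. apply (filterlim_locally (U := C_UniformSpace)). intros eps.
    generalize (filter_and _ _ (proj1 (filterlim_locally _ _) H1 eps)
                  (proj1 (filterlim_locally _ _) H2 eps)).
    apply filter_imp. intros y Hy. exact Hy.
Qed.

Lemma continuous_C_plus (f g : R -> C) (x : R) :
  continuous (U := C_UniformSpace) f x -> continuous (U := C_UniformSpace) g x ->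
  continuous (U := C_UniformSpace) (fun y => f y + g y)%C x.
Proof. intros. now apply (continuous_plus (V := C_R_NormedModule) f g x). Qed.

Lemma continuous_C_mult (f g : R -> C) (x : R) :
  continuous (U := C_UniformSpace) f x -> continuous (U := C_UniformSpace) g x ->
  continuous (U := C_UniformSpace) (fun y => f y * g y)%C x.
Proof.
  intros [f1 f2]%continuous_C_iff [g1 g2]%continuous_C_iff.
  apply continuous_C_iff. split.
  - apply (continuous_minus (V := R_NormedModule) (fun y => Re (f y) * Re (g y))
             (fun y => Im (f y) * Im (g y)) x);
      apply (continuous_mult (K := R_AbsRing)); assumption.
  - apply (continuous_plus (V := R_NormedModule) (fun y => Re (f y) * Im (g y))
             (fun y => Im (f y) * Re (g y)) x);
      apply (continuous_mult (K := R_AbsRing)); assumption.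
Qed.

Lemma continuous_C_const (c : C) (x : R) :
  continuous (U := C_UniformSpace) (fun _ : R => c) x.
Proof. apply continuous_const. Qed.

Lemma continuous_RtoC (f : R -> R) (x : R) :
  continuous f x -> continuous (U := C_UniformSpace) (fun y => RtoC (f y)) x.
Proof.
  intros H. apply continuous_C_iff. split; [exact H|apply continuous_const].
Qed.

Lemma continuous_R_Cmod (f : R -> C) (x : R) :
  continuous (U := C_UniformSpace) f x -> continuous (fun y => Cmod (f y)) x.
Proof.
  intros H. apply (filterlim_locally (U := R_UniformSpace)). intros eps.
  destruct (proj1 (continuous_Cmod f x) H eps (cond_pos eps)) as [d [Hd Hy]].
  exists (mkposreal d Hd). intros y Hyd.
  eapply Rle_lt_trans; [|exact (Hy y Hyd)].
  change (Rabs (Cmod (f y) - Cmod (f x)) <= Cmod (f y - f x)).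
  generalize (Cmod_triangle (f y - f x) (f x)), (Cmod_triangle (f x - f y) (f y)).
  rewrite (Cmod_minus_sym (f x)).
  replace (f y - f x + f x)%C with (f y) by ring.
  replace (f x - f y + f y)%C with (f x) by ring.
  intros. apply Rabs_le. lra.
Qed.

(** * Linear systems *)

(** Indexing by lists over an arbitrary type lets a linear system have [option nat] as its set of
    columns. *)
Definition lsum {B : Type} (l : list B) (F : B -> C) : C :=
  fold_right (fun j s => (F j + s)%C) (RtoC 0) l.

Lemma lsum_ext {B : Type} (l : list B) (F G : B -> C) :
  (forall j, In j l -> F j = G j) -> lsum l F = lsum l G.
Proof.
  induction l as [|a l IH]; intros H; simpl; [reflexivity|].
  rewrite (H a), IH; auto with datatypes.
Qed.

Lemma lsum_plus {B : Type} (l : list B) (F G : B -> C) :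
  lsum l (fun j => F j + G j)%C = (lsum l F + lsum l G)%C.
Proof. induction l as [|a l IH]; simpl; [ring|rewrite IH; ring]. Qed.

Lemma lsum_minus {B : Type} (l : list B) (F G : B -> C) :
  lsum l (fun j => F j - G j)%C = (lsum l F - lsum l G)%C.
Proof. induction l as [|a l IH]; simpl; [ring|rewrite IH; ring]. Qed.

Lemma lsum_scal {B : Type} (l : list B) (c : C) (F : B -> C) :
  lsum l (fun j => c * F j)%C = (c * lsum l F)%C.
Proof. induction l as [|a l IH]; simpl; [ring|rewrite IH; ring]. Qed.

Lemma lsum_zero {B : Type} (l : list B) : lsum l (fun _ => RtoC 0) = RtoC 0.
Proof. induction l as [|a l IH]; simpl; [ring|rewrite IH; ring]. Qed.

Lemma lsum_app {B : Type} (l1 l2 : list B) (F : B -> C) :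
  lsum (l1 ++ l2) F = (lsum l1 F + lsum l2 F)%C.
Proof. induction l1 as [|a l IH]; simpl; [ring|rewrite IH; ring]. Qed.

Lemma lsum_map {A B : Type} (h : A -> B) (l : list A) (F : B -> C) :
  lsum (map h l) F = lsum l (fun i => F (h i)).
Proof. induction l as [|a l IH]; simpl; [ring|rewrite IH; ring]. Qed.

Lemma lsum_exchange {A B : Type} (l : list A) (l' : list B) (F : A -> B -> C) :
  lsum l (fun i => lsum l' (F i)) = lsum l' (fun j => lsum l (fun i => F i j)).
Proof.
  induction l as [|a l IH]; simpl; [now rewrite lsum_zero|].
  now rewrite IH, lsum_plus.
Qed.

Lemma lsum_indicator (l : list nat) (p : nat) (F : nat -> C) :
  NoDup l -> In p l ->
  lsum l (fun i => if Nat.eqb i p then F i else RtoC 0) = F p.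
Proof.
  intros Hl Hp. destruct (in_split p l Hp) as [l1 [l2 ->]].
  apply NoDup_remove_2 in Hl.
  rewrite lsum_app; simpl. rewrite Nat.eqb_refl.
  assert (H0 : forall l, ~ In p l ->
            lsum l (fun i => if Nat.eqb i p then F i else RtoC 0) = RtoC 0).
  { intros l Hpl. rewrite (lsum_ext _ _ (fun _ => RtoC 0)); [apply lsum_zero|].
    intros j Hj. destruct (Nat.eqb_spec j p); subst; tauto. }
  rewrite 2!H0; [ring| |]; intros H; apply Hl, in_app_iff; auto.
Qed.

Lemma Cmod_lsum_le {B : Type} (l : list B) (F : B -> C) (G : B -> R) (M : R) :
  (forall j, In j l -> Cmod (F j) <= M * G j) ->
  Cmod (lsum l F) <= M * fold_right (fun j s => G j + s) 0 l.
Proof.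
  induction l as [|a l IH]; intros H; simpl.
  - rewrite Cmod_0. lra.
  - eapply Rle_trans; [apply Cmod_triangle|].
    rewrite Rmult_plus_distr_l.
    apply Rplus_le_compat; auto with datatypes.
Qed.

(** Gaussian elimination by induction on the rows: a row with a nonzero entry serves as pivot and
    removes one column, a zero row is dropped. Stated for more unknowns than equations, it gives
    solvability without determinants. *)
Lemma homogeneous_system {A B : Type} (rows : list A) : forall (cols : list B)
  (a : A -> B -> C), NoDup cols -> (length rows < length cols)%nat ->
  exists x : B -> C, (exists j, In j cols /\ x j <> RtoC 0) /\
    forall i, In i rows -> lsum cols (fun j => a i j * x j)%C = RtoC 0.
Proof.
  induction rows as [|r rows IH]; intros cols a Hnd Hlen.
  - destruct cols as [|c cols]; simpl in Hlen; [lia|].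
    exists (fun _ => RtoC 1). split; [|now intros i []].
    exists c. split; [now left|]. intros E%(f_equal Re). simpl in E. lra.
  - destruct (classic (exists p, In p cols /\ a r p <> RtoC 0)) as [[p [Hp Hap]]|Hz].
    + destruct (in_split p cols Hp) as [l1 [l2 ->]].
      assert (Hlen' : (length rows < length (l1 ++ l2))%nat).
      { rewrite length_app in *. simpl in Hlen. lia. }
      (* Each remaining row minus [a i p / a r p] times the pivot row, which clears column [p]. *)
      destruct (IH (l1 ++ l2) (fun i j => (a i j - a i p * (a r j / a r p))%C)
                  (NoDup_remove_1 _ _ _ Hnd) Hlen') as [x [[q [Hq Hxq]] Hx]].
      assert (Hnp := NoDup_remove_2 _ _ _ Hnd).
      assert (Hsplit : forall F : B -> C,
                 lsum (l1 ++ p :: l2) F = (F p + lsum (l1 ++ l2) F)%C).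
      { intros F. rewrite 2!lsum_app. simpl. ring. }
      (* The pivot row solved for its own unknown. *)
      set (y0 := (- (/ a r p * lsum (l1 ++ l2) (fun j => a r j * x j)))%C).
      exists (fun j => if excluded_middle_informative (j = p) then y0 else x j).
      assert (Hrest : forall i,
        lsum (l1 ++ l2) (fun j => a i j *
           (if excluded_middle_informative (j = p) then y0 else x j))%C
        = lsum (l1 ++ l2) (fun j => a i j * x j)%C).
      { intros i. apply lsum_ext. intros j Hj.
        destruct (excluded_middle_informative (j = p)); [subst; tauto|reflexivity]. }
      split.
      * exists q. split.
        -- apply in_app_iff in Hq. apply in_app_iff. simpl. tauto.
        -- destruct (excluded_middle_informative (q = p)); [subst; tauto|exact Hxq].
      * intros i Hi. rewrite Hsplit, Hrest.
        destruct (excluded_middle_informative (p = p)) as [_|]; [|tauto].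
        unfold y0. destruct Hi as [<-|Hi].
        -- field. exact Hap.
        -- specialize (Hx i Hi).
           rewrite (lsum_ext _ _ (fun j => a i j * x j + (- (a i p / a r p)) * (a r j * x j))%C)
             in Hx by (intros; field; exact Hap).
           rewrite lsum_plus, lsum_scal in Hx.
           rewrite <- Hx. field. exact Hap.
    + assert (Hlen' : (length rows < length cols)%nat) by (simpl in Hlen; lia).
      destruct (IH cols a Hnd Hlen') as [x [Hx1 Hx2]].
      exists x. split; [exact Hx1|]. intros i [<-|Hi]; [|auto].
      rewrite (lsum_ext _ _ (fun _ => RtoC 0)); [apply lsum_zero|].
      intros j Hj. destruct (classic (a r j = RtoC 0)) as [E|E].
      * rewrite E. ring.
      * exfalso. eauto.
Qed.

(** * The Fredholm alternative for small plus finite rank *)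

(** A Banach space under the sup norm over [D], without naming that norm. Functions are total;
    [fs_closed] also makes membership independent of the values off [D]. *)
Record function_space {X : Type} (D : X -> Prop) (E : (X -> C) -> Prop) : Prop := {
  fs_zero : E (fun _ => RtoC 0);
  fs_lin : forall (a : C) v w, E v -> E w -> E (fun t => a * v t + w t)%C;
  fs_bounded : forall v, E v -> exists M, forall t, D t -> Cmod (v t) <= M;
  fs_closed : forall v : X -> C,
    (forall eps, 0 < eps ->
       exists w, E w /\ forall t, D t -> Cmod (v t - w t) <= eps) -> E v
}.

(** The bound is stated for every majorant [M] of [v] on [D], so no supremum has to be formed; [q]
    stands for the operator norm. *)
Record bounded_operator {X : Type} (D : X -> Prop) (E : (X -> C) -> Prop)
  (S : (X -> C) -> X -> C) (q : R) : Prop := {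
  op_mem : forall v, E v -> E (S v);
  op_lin : forall (a : C) v w t, E v -> E w -> D t ->
    S (fun s => a * v s + w s)%C t = (a * S v t + S w t)%C;
  op_bound : forall v M, E v -> (forall t, D t -> Cmod (v t) <= M) ->
    forall t, D t -> Cmod (S v t) <= q * M
}.

Record bounded_functional {X : Type} (D : X -> Prop) (E : (X -> C) -> Prop)
  (l : (X -> C) -> C) (q : R) : Prop := {
  fn_lin : forall (a : C) v w, E v -> E w ->
    l (fun s => a * v s + w s)%C = (a * l v + l w)%C;
  fn_bound : forall v M, E v -> (forall t, D t -> Cmod (v t) <= M) ->
    Cmod (l v) <= q * M
}.

(** The rate [e] bounds all later terms at once and so passes to the limit; [neumann] uses one [e]
    for all points, which makes the convergence uniform. *)
Lemma C_cauchy_limit (z : nat -> C) (e : nat -> R) :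
  (forall n k, Cmod (z (n + k)%nat - z n) <= e n) ->
  (forall eps, 0 < eps -> exists n, e n < eps) ->
  exists l : C, forall n, Cmod (l - z n) <= e n.
Proof.
  intros Hz He.
  destruct (proj1 (filterlim_locally_cauchy (U := C_R_CompleteNormedModule)
     (F := eventually) z)) as [l Hl].
  - intros eps. destruct (He (eps / 2)) as [n Hn].
    { generalize (cond_pos eps). lra. }
    exists (fun m => (n <= m)%nat). split; [exists n; auto|].
    intros u v Hu Hv.
    assert (H : Cmod (z v - z u) < eps).
    { eapply Rle_lt_trans; [apply (Cmod_minus_triangle _ (z n))|].
      replace u with (n + (u - n))%nat by lia.
      replace v with (n + (v - n))%nat by lia.
      generalize (Hz n (u - n)%nat), (Hz n (v - n)%nat).
      rewrite (Cmod_minus_sym (z n)). lra. }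
    split; (eapply Rle_lt_trans; [|exact H]).
    + apply (re_le_Cmod (z v - z u)).
    + apply (im_le_Cmod (z v - z u)).
  - exists l. intros n. apply le_epsilon. intros eps Heps.
    destruct (proj1 (filterlim_Cmod z l) Hl eps Heps) as [N HN].
    specialize (HN (n + N)%nat ltac:(lia)).
    eapply Rle_trans; [apply (Cmod_minus_triangle _ (z (n + N)%nat))|].
    generalize (Hz n N). rewrite (Cmod_minus_sym l). lra.
Qed.

Section SpaceFacts.

Context {X : Type} {D : X -> Prop} {E : (X -> C) -> Prop}.
Context (HE : function_space D E).

Lemma fs_lsum {B : Type} (l : list B) (c : B -> C) (e : B -> X -> C) :
  (forall i, In i l -> E (e i)) -> E (fun t => lsum l (fun i => c i * e i t)%C).
Proof.
  induction l as [|a l IH]; intros H; simpl.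
  - apply (fs_zero _ _ HE).
  - apply (fs_lin _ _ HE); auto with datatypes.
Qed.

Lemma fs_plus (v w : X -> C) : E v -> E w -> E (fun t => v t + w t)%C.
Proof.
  intros Hv Hw. replace (fun t => v t + w t)%C with (fun t => 1 * v t + w t)%C
    by (apply functional_extensionality; intros; ring).
  now apply (fs_lin _ _ HE).
Qed.

Lemma fs_scal (a : C) (v : X -> C) : E v -> E (fun t => a * v t)%C.
Proof.
  intros Hv. replace (fun t => a * v t)%C with (fun t => a * v t + (fun _ => RtoC 0) t)%C
    by (apply functional_extensionality; intros; ring).
  apply (fs_lin _ _ HE); [exact Hv|apply (fs_zero _ _ HE)].
Qed.

Lemma fs_minus (v w : X -> C) : E v -> E w -> E (fun t => v t - w t)%C.
Proof.
  intros Hv Hw. replace (fun t => v t - w t)%C with (fun t => (-1) * w t + v t)%C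
    by (apply functional_extensionality; intros; ring).
  now apply (fs_lin _ _ HE).
Qed.

Lemma op_minus {S q} (HS : bounded_operator D E S q) (v w : X -> C) (t : X) :
  E v -> E w -> D t -> S (fun s => v s - w s)%C t = (S v t - S w t)%C.
Proof.
  intros Hv Hw Ht. replace (fun t => v t - w t)%C with (fun t => (-1) * w t + v t)%C
    by (apply functional_extensionality; intros; ring).
  rewrite (op_lin _ _ _ _ HS) by assumption. ring.
Qed.

Lemma op_zero {S q} (HS : bounded_operator D E S q) (v : X -> C) (t : X) :
  E v -> (forall s, D s -> v s = RtoC 0) -> D t -> S v t = RtoC 0.
Proof.
  intros Hv H Ht. apply Cmod_eq_0. apply Rle_antisym; [|apply Cmod_ge_0].
  rewrite <- (Rmult_0_r q). apply (op_bound _ _ _ _ HS); try assumption.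
  intros s Hs. rewrite (H s Hs), Cmod_0. lra.
Qed.

Lemma op_lsum {S q} (HS : bounded_operator D E S q) {B : Type} (l : list B)
  (c : B -> C) (e : B -> X -> C) (t : X) :
  (forall i, In i l -> E (e i)) -> D t ->
  S (fun s => lsum l (fun i => c i * e i s)%C) t
  = lsum l (fun i => c i * S (e i) t)%C.
Proof.
  intros H Ht. induction l as [|a l IH]; simpl.
  - apply (op_zero HS); [apply (fs_zero _ _ HE)|reflexivity|exact Ht].
  - rewrite (op_lin _ _ _ _ HS (c a) (e a)); try assumption; auto with datatypes.
    + rewrite IH; auto with datatypes.
    + apply fs_lsum; auto with datatypes.
Qed.

Lemma op_scal {S q} (HS : bounded_operator D E S q) (a : C) (v : X -> C) (t : X) :
  E v -> D t -> S (fun s => a * v s)%C t = (a * S v t)%C.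
Proof.
  intros Hv Ht. replace (fun t => a * v t)%C with (fun t => a * v t + (fun _ => RtoC 0) t)%C
    by (apply functional_extensionality; intros; ring).
  rewrite (op_lin _ _ _ _ HS a v _ t Hv (fs_zero _ _ HE) Ht).
  rewrite (op_zero HS _ t (fs_zero _ _ HE)); [ring|reflexivity|exact Ht].
Qed.

Lemma fn_zero {l q} (Hl : bounded_functional D E l q) (v : X -> C) :
  E v -> (forall s, D s -> v s = RtoC 0) -> l v = RtoC 0.
Proof.
  intros Hv H. apply Cmod_eq_0. apply Rle_antisym; [|apply Cmod_ge_0].
  rewrite <- (Rmult_0_r q). apply (fn_bound _ _ _ _ Hl); try assumption.
  intros s Hs. rewrite (H s Hs), Cmod_0. lra.
Qed.

Lemma fn_scal {l q} (Hl : bounded_functional D E l q) (a : C) (v : X -> C) :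
  E v -> l (fun s => a * v s)%C = (a * l v)%C.
Proof.
  intros Hv. replace (fun t => a * v t)%C with (fun t => a * v t + (fun _ => RtoC 0) t)%C
    by (apply functional_extensionality; intros; ring).
  rewrite (fn_lin _ _ _ _ Hl a v _ Hv (fs_zero _ _ HE)).
  rewrite (fn_zero Hl _ (fs_zero _ _ HE)); [ring|reflexivity].
Qed.

Lemma fn_lsum {l q} (Hl : bounded_functional D E l q) {B : Type} (r : list B)
  (c : B -> C) (e : B -> X -> C) :
  (forall i, In i r -> E (e i)) ->
  l (fun s => lsum r (fun i => c i * e i s)%C) = lsum r (fun i => c i * l (e i))%C.
Proof.
  intros H. induction r as [|a r IH]; simpl.
  - apply (fn_zero Hl); [apply (fs_zero _ _ HE)|reflexivity].
  - rewrite (fn_lin _ _ _ _ Hl (c a) (e a)); auto with datatypes.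
    + rewrite IH; auto with datatypes.
    + apply fs_lsum; auto with datatypes.
Qed.

(** The iteration u -> S u + g started at 0, whose iterates are the partial sums of the Neumann
    series. *)
Lemma neumann {S : (X -> C) -> X -> C} {q : R} (HS : bounded_operator D E S q)
  (Hq0 : 0 <= q) (Hq1 : q < 1) (g : X -> C) (M : R) :
  E g -> (forall t, D t -> Cmod (g t) <= M) ->
  exists u, E u /\ (forall t, D t -> u t = (S u t + g t)%C) /\
    (forall t, D t -> Cmod (u t) <= / (1 - q) * M).
Proof.
  intros Hg HM.
  (* On an empty [D] the majorant [M] could be negative; a point of [D] forces [0 <= M]. *)
  destruct (classic (exists t, D t)) as [[t0 Ht0]|Hempty].
  2:{ exists g. split; [exact Hg|]. split; intros t Ht; exfalso; eauto. }
  assert (HM0 : 0 <= M) by (eapply Rle_trans; [apply Cmod_ge_0|exact (HM _ Ht0)]).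
  set (u := fix u n := match n with
                       | O => fun _ => RtoC 0
                       | Datatypes.S n => fun t => (S (u n) t + g t)%C end).
  assert (Hu : forall n, E (u n)).
  { induction n; simpl; [apply (fs_zero _ _ HE)|].
    apply fs_plus; [|exact Hg]. now apply (op_mem _ _ _ _ HS). }
  assert (Hstep : forall n t, D t -> Cmod (u (Datatypes.S n) t - u n t) <= q ^ n * M).
  { induction n as [|n IH]; intros t Ht.
    - simpl. rewrite (op_zero HS); [|apply (fs_zero _ _ HE)|reflexivity|exact Ht].
      replace (0 + g t - 0)%C with (g t) by ring. rewrite Rmult_1_l. auto.
    - change (u (Datatypes.S (Datatypes.S n)) t - u (Datatypes.S n) t)%C
        with (S (u (Datatypes.S n)) t + g t - (S (u n) t + g t))%C.
      replace (S (u (Datatypes.S n)) t + g t - (S (u n) t + g t))%C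
        with (S (u (Datatypes.S n)) t - S (u n) t)%C by ring.
      rewrite <- (op_minus HS) by auto. simpl pow. rewrite Rmult_assoc.
      apply (op_bound _ _ _ _ HS); auto. apply fs_minus; auto. }
  (* The tail from index n on of the geometric series with ratio [q] and first term [M]. *)
  set (e := fun n => q ^ n * (/ (1 - q) * M)).
  assert (Hfar : forall t, D t -> forall n k, Cmod (u (n + k)%nat t - u n t) <= e n).
  { intros t Ht n k.
    (* The exact partial sum keeps the induction on [k] going; the bound by the whole tail would not
       reproduce itself. *)
    assert (H : Cmod (u (n + k)%nat t - u n t)
                <= (q ^ n - q ^ (n + k)) * (/ (1 - q) * M)).
    { induction k as [|k IH].
      - rewrite Nat.add_0_r. replace (u n t - u n t)%C with (RtoC 0) by ring.
        rewrite Cmod_0. lra.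
      - rewrite Nat.add_succ_r.
        eapply Rle_trans; [apply (Cmod_minus_triangle _ (u (n + k)%nat t))|].
        eapply Rle_trans; [apply (Rplus_le_compat _ _ _ _ (Hstep _ t Ht) IH)|].
        right. simpl. field. lra. }
    eapply Rle_trans; [exact H|]. unfold e.
    apply Rmult_le_compat_r.
    - apply Rmult_le_pos; [|exact HM0]. left. apply Rinv_0_lt_compat. lra.
    - assert (0 <= q ^ (n + k)) by now apply pow_le. lra. }
  assert (He : forall eps, 0 < eps -> exists n, e n < eps).
  { intros eps Heps.
    assert (Hc : 0 <= / (1 - q) * M).
    { apply Rmult_le_pos; [|exact HM0]. left. apply Rinv_0_lt_compat. lra. }
    destruct (pow_lt_1_zero q) with (y := eps / (/ (1 - q) * M + 1)) as [n Hn].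
    - rewrite Rabs_pos_eq; lra.
    - apply Rdiv_lt_0_compat; lra.
    - exists n. specialize (Hn n (Nat.le_refl n)).
      rewrite Rabs_pos_eq in Hn by now apply pow_le.
      unfold e. apply Rlt_div_r in Hn; [|lra].
      assert (0 <= q ^ n) by now apply pow_le. nra. }
  (* The limit is taken pointwise; its values off [D] are arbitrary. *)
  set (U := fun t => epsilon (inhabits (RtoC 0)) (fun l => forall n, Cmod (l - u n t) <= e n)).
  assert (HU : forall t, D t -> forall n, Cmod (U t - u n t) <= e n).
  { intros t Ht. unfold U. apply epsilon_spec.
    apply C_cauchy_limit; [|exact He]. now apply Hfar. }
  assert (HEU : E U).
  { apply (fs_closed _ _ HE). intros eps Heps. destruct (He eps Heps) as [n Hn].
    exists (u n). split; [apply Hu|]. intros t Ht.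
    eapply Rle_trans; [now apply HU|]. lra. }
  exists U. split; [exact HEU|]. split; intros t Ht.
  - apply Ceq_minus. apply Cmod_zero_of_small. intros eps Heps.
    destruct (He (eps / 2)) as [n Hn]; [lra|].
    (* Uses u_(n+1) = S u_n + g; both differences are then controlled by the rate. *)
    replace (U t - (S U t + g t))%C
      with ((U t - u (Datatypes.S n) t) - (S U t - S (u n) t))%C by (simpl; ring).
    eapply Rle_trans; [apply Cmod_minus_le|].
    assert (Hen : e (Datatypes.S n) = q * e n) by (unfold e; simpl; ring).
    assert (H1 := HU t Ht (Datatypes.S n)). rewrite Hen in H1.
    assert (H2 : Cmod (S U t - S (u n) t) <= q * e n).
    { rewrite <- (op_minus HS) by auto. apply (op_bound _ _ _ _ HS); auto.
      apply fs_minus; auto. }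
    assert (0 <= e n) by (eapply Rle_trans; [apply Cmod_ge_0|apply (HU t Ht n)]).
    nra.
  (* The iterate at n = 0 is 0, so the rate there bounds the solution. *)
  - generalize (HU t Ht O). unfold e. simpl.
    replace (U t - 0)%C with (U t) by ring. rewrite Rmult_1_l. auto.
Qed.

(** With F the finite-rank part, it suffices to solve (I - S - F) U_p = k_p for each [p]: if (I - S)
    h = g, then (I - S - F) h falls short of g by sum l_i(h) k_i, and adding sum l_i(h) U_i to h
    makes up for it. Injectivity enters only in the existence of the U_p. *)
Lemma fredholm {S : (X -> C) -> X -> C} {q : R} (HS : bounded_operator D E S q)
  (Hq0 : 0 <= q) (Hq1 : q < 1) (r : list nat) (k : nat -> X -> C)
  (l : nat -> (X -> C) -> C) (L : R) (Hr : NoDup r) (Hk : forall i, In i r -> E (k i))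
  (Hl : forall i, In i r -> bounded_functional D E (l i) L)
  (Hinj : forall v, E v ->
     (forall t, D t -> v t = (S v t + lsum r (fun i => l i v * k i t))%C) ->
     forall t, D t -> v t = RtoC 0) :
  exists Cst, forall g M, E g -> (forall t, D t -> Cmod (g t) <= M) ->
    exists u, E u /\
      (forall t, D t -> u t = (S u t + lsum r (fun i => l i u * k i t) + g t)%C) /\
      (forall t, D t -> Cmod (u t) <= Cst * M).
Proof.
  (* [e i] is the image of [k i] under the inverse of I - S. *)
  assert (Hex : exists e : nat -> X -> C, forall i, In i r ->
            E (e i) /\ forall t, D t -> e i t = (S (e i) t + k i t)%C).
  { apply (choice (fun i e => In i r -> E e /\ forall t, D t -> e t = (S e t + k i t)%C)).
    intros i. destruct (classic (In i r)) as [Hi|Hi].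
    - destruct (fs_bounded _ _ HE _ (Hk i Hi)) as [M HM].
      destruct (neumann HS Hq0 Hq1 _ M (Hk i Hi) HM) as [u [H1 [H2 _]]].
      exists u. auto.
    - exists (fun _ => RtoC 0). tauto. }
  destruct Hex as [e He].
  assert (HU : exists U : nat -> X -> C, forall p, In p r ->
    E (U p) /\ forall t, D t ->
      U p t = (S (U p) t + lsum r (fun i => l i (U p) * k i t) + k p t)%C).
  { apply (choice (fun p U => In p r -> E U /\ forall t, D t ->
      U t = (S U t + lsum r (fun i => l i U * k i t) + k p t)%C)).
    intros p. destruct (classic (In p r)) as [Hp|Hp];
      [|exists (fun _ => RtoC 0); tauto].
    (* Row j reads x_j - sum x_i l_j(e_i) - s delta_jp = 0, where the column [None] carries the
       extra unknown s. Having one more column than rows guarantees a nonzero solution. *)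
    set (a := fun j o => match o with
       | None => if Nat.eqb j p then RtoC (-1) else RtoC 0
       | Some i => ((if Nat.eqb i j then RtoC 1 else RtoC 0) - l j (e i))%C end).
    destruct (homogeneous_system r (None :: map Some r) a) as [x [Hx1 Hx2]].
    { constructor.
      - rewrite in_map_iff. intros [i [Hi _]]. discriminate.
      - apply Injective_map_NoDup; [intros i j Hij; congruence|exact Hr]. }
    { simpl. rewrite length_map. lia. }
    set (s := x None). set (u := fun t => lsum r (fun i => x (Some i) * e i t)%C).
    assert (HEu : E u) by (apply fs_lsum; intros; now apply He).
    assert (Hlu : forall j, In j r ->
              x (Some j) = (l j u + (if Nat.eqb j p then s else RtoC 0))%C).
    { intros j Hj. specialize (Hx2 j Hj). simpl in Hx2.
      rewrite lsum_map in Hx2. unfold a in Hx2.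
      rewrite (lsum_ext _ _ (fun i => (if Nat.eqb i j then x (Some i) else RtoC 0)
          + (-1) * (x (Some i) * l j (e i)))%C) in Hx2.
      2:{ intros i _. destruct (Nat.eqb i j); ring. }
      rewrite lsum_plus, lsum_scal, lsum_indicator in Hx2 by assumption.
      unfold u. rewrite (fn_lsum (Hl j Hj)) by (intros; now apply He).
      apply Ceq_minus. eapply eq_trans; [|exact Hx2]. unfold s.
      destruct (Nat.eqb j p); ring. }
    assert (Hu : forall t, D t ->
      u t = (S u t + lsum r (fun i => l i u * k i t) + s * k p t)%C).
    { intros t Ht. unfold u at 1.
      rewrite (lsum_ext _ _ (fun i => x (Some i) * S (e i) t + x (Some i) * k i t)%C).
      2:{ intros i Hi. rewrite (proj2 (He i Hi) t Ht). ring. }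
      rewrite lsum_plus, <- (op_lsum HS) by (auto; intros; now apply He).
      fold u. rewrite <- Cplus_assoc. f_equal.
      rewrite (lsum_ext _ _ (fun i => l i u * k i t
         + (if Nat.eqb i p then s * k i t else RtoC 0))%C).
      2:{ intros i Hi. rewrite (Hlu i Hi). destruct (Nat.eqb i p); ring. }
      rewrite lsum_plus, lsum_indicator by assumption. reflexivity. }
    (* For s = 0 the function u would be a null vector, hence 0, and then every unknown would
       vanish. *)
    assert (Hs : s <> RtoC 0).
    { intros Hs.
      assert (Hu0 : forall t, D t -> u t = RtoC 0).
      { apply Hinj; [exact HEu|]. intros t Ht. rewrite (Hu t Ht) at 1.
        rewrite Hs. ring. }
      destruct Hx1 as [[j|] [Hj Hxj]]; [|tauto].
      destruct Hj as [Hj|Hj]; [discriminate|].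
      apply in_map_iff in Hj. destruct Hj as [j' [[= ->] Hj]].
      apply Hxj. rewrite (Hlu j Hj), (fn_zero (Hl j Hj) u HEu Hu0), Hs.
      destruct (Nat.eqb j p); ring. }
    exists (fun t => / s * u t)%C. intros _. split; [now apply fs_scal|].
    intros t Ht. rewrite (op_scal HS) by assumption.
    rewrite (lsum_ext _ _ (fun i => / s * (l i u * k i t))%C).
    2:{ intros i Hi. rewrite (fn_scal (Hl i Hi)) by assumption. ring. }
    rewrite lsum_scal. rewrite (Hu t Ht) at 1. field. exact Hs. }
  destruct HU as [U HU].
  assert (HUb : exists B : nat -> R, forall i, In i r ->
            forall t, D t -> Cmod (U i t) <= B i).
  { apply (choice (fun i B => In i r -> forall t, D t -> Cmod (U i t) <= B)).
    intros i. destruct (classic (In i r)) as [Hi|Hi]; [|exists 0; tauto].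
    destruct (fs_bounded _ _ HE _ (proj1 (HU i Hi))) as [B HB]. eauto. }
  destruct HUb as [B HB].
  (* [h] is bounded by [/ (1 - q) * M], each [l i h] by [L] times that, and each [U i] by the fixed
     [B i]. *)
  exists (/ (1 - q) + L * / (1 - q) * fold_right (fun j s => B j + s) 0 r).
  intros g M Hg HM.
  destruct (neumann HS Hq0 Hq1 g M Hg HM) as [h [Hh [Hheq Hhb]]].
  set (w := fun t => lsum r (fun i => l i h * U i t)%C).
  assert (Hw : E w) by (apply fs_lsum; intros; now apply HU).
  exists (fun t => 1 * h t + w t)%C.
  split; [now apply (fs_lin _ _ HE)|]. split; intros t Ht.
  - rewrite (op_lin _ _ _ _ HS) by assumption.
    rewrite (lsum_ext r (fun i => _ * k i t)%C
       (fun i => l i h * k i t + l i w * k i t)%C).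
    2:{ intros i Hi. rewrite (fn_lin _ _ _ _ (Hl i Hi)) by assumption. ring. }
    rewrite lsum_plus.
    assert (Hwt : w t = (S w t + (lsum r (fun i => l i w * k i t)
                     + lsum r (fun i => l i h * k i t)))%C).
    { unfold w at 1.
      rewrite (lsum_ext _ _ (fun i => l i h * S (U i) t +
         (lsum r (fun j => l i h * l j (U i) * k j t) + l i h * k i t))%C).
      2:{ intros i Hi. rewrite (proj2 (HU i Hi) t Ht) at 1.
          rewrite (lsum_ext r (fun j => l i h * l j (U i) * k j t)%C
            (fun j => l i h * (l j (U i) * k j t))%C) by (intros; ring).
          rewrite lsum_scal. ring. }
      rewrite 2!lsum_plus, <- (op_lsum HS) by (auto; intros; now apply HU).
      fold w. f_equal. f_equal. rewrite lsum_exchange. apply lsum_ext.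
      intros j Hj. unfold w. rewrite (fn_lsum (Hl j Hj)) by (intros; now apply HU).
      rewrite (Cmult_comm _ (k j t)), <- lsum_scal. apply lsum_ext. intros; ring. }
    rewrite Hwt at 1. rewrite (Hheq t Ht) at 1. ring.
  - eapply Rle_trans; [apply Cmod_triangle|].
    rewrite Cmult_1_l, Rmult_plus_distr_r. apply Rplus_le_compat; [auto|].
    unfold w. rewrite Rmult_assoc, (Rmult_comm (fold_right _ _ _)), <- Rmult_assoc.
    apply Cmod_lsum_le.
    intros i Hi. rewrite Cmod_mult.
    apply Rmult_le_compat; try apply Cmod_ge_0.
    + rewrite Rmult_assoc. apply (fn_bound _ _ _ _ (Hl i Hi)); assumption.
    + now apply HB.
Qed.

End SpaceFacts.

(** * Geometry of the contour *)

Lemma R_continuous_bounded (f : R -> R) (a b : R) :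
  a <= b -> (forall x, continuous f x) -> exists B, forall x, a <= x <= b -> f x <= B.
Proof.
  intros Hab Hf. destruct (continuity_ab_maj f a b Hab) as [M [HM _]].
  - intros x _. apply continuity_pt_filterlim. apply Hf.
  - exists (f M). exact HM.
Qed.

Lemma shift_into_period (a th : R) : exists n : Z,
  a <= th + IZR n * (2 * PI) < a + 2 * PI.
Proof.
  assert (HPI := PI_RGT_0).
  destruct (archimed ((a - th) / (2 * PI))) as [H1 H2].
  set (m := up ((a - th) / (2 * PI))) in *.
  assert (E : a - th = (a - th) / (2 * PI) * (2 * PI)) by (field; lra).
  (* [up] leaves a gap in (0, 1]; a gap of exactly 1 would land on the excluded right end. *)
  destruct (Req_dec (IZR m - (a - th) / (2 * PI)) 1) as [E1|E1].
  - exists (m - 1)%Z. rewrite minus_IZR. nra.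
  - exists m. nra.
Qed.

Section Contour.

Context {gam : R -> C} (Hgam : is_contour gam).

Lemma ex_derive_Re_gam th : ex_derive (fun x => Re (gam x)) th.
Proof. exact (proj1 (contour_C2_re _ Hgam) 1%nat th ltac:(lia)). Qed.

Lemma ex_derive_Im_gam th : ex_derive (fun x => Im (gam x)) th.
Proof. exact (proj1 (contour_C2_im _ Hgam) 1%nat th ltac:(lia)). Qed.

Lemma continuous_gam th : continuous (U := C_UniformSpace) gam th.
Proof.
  apply continuous_C_iff; split.
  - apply (ex_derive_continuous (fun x => Re (gam x))), ex_derive_Re_gam.
  - apply (ex_derive_continuous (fun x => Im (gam x))), ex_derive_Im_gam.
Qed.

Lemma continuous_dgam th : continuous (U := C_UniformSpace) (dgam gam) th.
Proof.
  apply continuous_C_iff; split.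
  - apply (ex_derive_continuous (Derive (fun x => Re (gam x)))).
    exact (proj1 (contour_C2_re _ Hgam) 2%nat th ltac:(lia)).
  - apply (ex_derive_continuous (Derive (fun x => Im (gam x)))).
    exact (proj1 (contour_C2_im _ Hgam) 2%nat th ltac:(lia)).
Qed.

Lemma gam_shift (n : Z) th : gam (th + IZR n * (2 * PI)) = gam th.
Proof.
  assert (Hnat : forall (m : nat) x, gam (x + INR m * (2 * PI)) = gam x).
  { induction m as [|m IH]; intros x.
    - f_equal. change (INR 0) with 0. ring.
    - rewrite S_INR, <- (IH x), <- (contour_periodic _ Hgam (x + INR m * (2 * PI))).
      f_equal. ring. }
  destruct (Z.le_gt_cases 0 n) as [Hn|Hn].
  - rewrite <- (Z2Nat.id n Hn), <- INR_IZR_INZ. apply Hnat.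
  - replace th with (th + IZR n * (2 * PI) + INR (Z.to_nat (- n)) * (2 * PI)) at 2.
    + now rewrite Hnat.
    + rewrite INR_IZR_INZ, Z2Nat.id, opp_IZR by lia. ring.
Qed.

Lemma dgam_periodic th : dgam gam (th + 2 * PI) = dgam gam th.
Proof.
  assert (H : forall f : C -> R, Derive (fun x => f (gam x)) (th + 2 * PI)
                                 = Derive (fun x => f (gam x)) th).
  { intros f. transitivity (Derive (fun x => f (gam (x + 2 * PI))) th).
    { symmetry. exact (Derive_n_comp_trans (fun x => f (gam x)) 1 th (2 * PI)). }
    apply Derive_ext. intros x. now rewrite (contour_periodic _ Hgam). }
  unfold dgam. now rewrite !H.
Qed.

Lemma dgam_shift (n : Z) th : dgam gam (th + IZR n * (2 * PI)) = dgam gam th.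
Proof.
  assert (Hnat : forall (m : nat) x, dgam gam (x + INR m * (2 * PI)) = dgam gam x).
  { induction m as [|m IH]; intros x.
    - f_equal. change (INR 0) with 0. ring.
    - rewrite S_INR, <- (IH x), <- (dgam_periodic (x + INR m * (2 * PI))).
      f_equal. ring. }
  destruct (Z.le_gt_cases 0 n) as [Hn|Hn].
  - rewrite <- (Z2Nat.id n Hn), <- INR_IZR_INZ. apply Hnat.
  - replace th with (th + IZR n * (2 * PI) + INR (Z.to_nat (- n)) * (2 * PI)) at 2.
    + now rewrite Hnat.
    + rewrite INR_IZR_INZ, Z2Nat.id, opp_IZR by lia. ring.
Qed.

Lemma dgam_bounded : exists B, 0 < B /\ forall th, Cmod (dgam gam th) <= B.
Proof.
  assert (HPI := PI_RGT_0).
  destruct (R_continuous_bounded (fun th => Cmod (dgam gam th)) 0 (2 * PI)) as [B HB];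
    [lra|intros x; apply continuous_R_Cmod, continuous_dgam|].
  exists (Rmax B 1). split; [generalize (Rmax_r B 1); lra|].
  intros th. destruct (shift_into_period 0 th) as [n Hn].
  rewrite <- (dgam_shift n th). eapply Rle_trans; [apply HB; lra|apply Rmax_l].
Qed.

Lemma speed_lower_bound : exists m, 0 < m /\ forall th, m <= Cmod (dgam gam th).
Proof.
  assert (HPI := PI_RGT_0).
  destruct (continuity_ab_min (fun th => Cmod (dgam gam th)) 0 (2 * PI)) as [x [Hx _]];
    [lra| |].
  - intros y _. apply continuity_pt_filterlim. apply continuous_R_Cmod, continuous_dgam.
  - exists (Cmod (dgam gam x)). split.
    + apply Cmod_gt_0, (contour_regular _ Hgam).
    + intros th. destruct (shift_into_period 0 th) as [n Hn].
      rewrite <- (dgam_shift n th). apply Hx. lra.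
Qed.

Lemma mean_value (f : R -> R) x y : (forall z, ex_derive f z) ->
  exists c, Rmin x y <= c <= Rmax x y /\ f y - f x = Derive f c * (y - x).
Proof.
  intros Hf. apply MVT_gen.
  - intros z _. apply Derive_correct, Hf.
  - intros z _. apply continuity_pt_filterlim. apply (ex_derive_continuous f), Hf.
Qed.

Lemma gam_lipschitz : exists B, 0 < B /\
  (forall x y, Cmod (gam x - gam y) <= B * Rabs (x - y)) /\
  (forall x, Cmod (dgam gam x) <= B).
Proof.
  (* The mean value theorem is applied to each component, at different points, hence the factor
     2. *)
  destruct dgam_bounded as [B [HB HdB]]. exists (2 * B). split; [lra|]. split.
  2:{ intros x. specialize (HdB x). lra. }
  intros x y.
  eapply Rle_trans; [apply Cmod_le_abs_sum|].
  change (Re (gam x - gam y)) with (Re (gam x) - Re (gam y)).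
  change (Im (gam x - gam y)) with (Im (gam x) - Im (gam y)).
  destruct (mean_value _ y x ex_derive_Re_gam) as [c [_ Hc]].
  destruct (mean_value _ y x ex_derive_Im_gam) as [d [_ Hd]].
  rewrite Hc, Hd, !Rabs_mult.
  assert (H1 := Rle_trans _ _ _ (re_le_Cmod (dgam gam c)) (HdB c)).
  assert (H2 := Rle_trans _ _ _ (im_le_Cmod (dgam gam d)) (HdB d)).
  change (Re (dgam gam c)) with (Derive (fun x => Re (gam x)) c) in H1.
  change (Im (dgam gam d)) with (Derive (fun x => Im (gam x)) d) in H2.
  rewrite <- Rmult_plus_distr_r.
  apply Rmult_le_compat_r; [apply Rabs_pos|].
  replace (2 * B) with (B + B) by ring. apply Rplus_le_compat; assumption.
Qed.

(** Parameters of the same point coincide once shifted into one period, so they differ by an integer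
    number of periods, which must be 0 here. *)
Lemma gam_injective x y : gam x = gam y -> Rabs (x - y) < 2 * PI -> x = y.
Proof.
  assert (HPI := PI_RGT_0). intros E Hxy.
  destruct (shift_into_period 0 x) as [n Hn]. destruct (shift_into_period 0 y) as [m Hm].
  assert (H : x + IZR n * (2 * PI) = y + IZR m * (2 * PI)).
  { apply (contour_simple _ Hgam); [lra|lra|]. now rewrite !gam_shift. }
  apply Rabs_def2 in Hxy.
  assert (H1 : IZR (m - n) < IZR 1) by (rewrite minus_IZR; nra).
  assert (H2 : IZR (-1) < IZR (m - n)) by (rewrite minus_IZR; nra).
  apply lt_IZR in H1, H2. replace m with n in H by lia. lra.
Qed.

(** By continuity the derivative keeps at least half of its modulus near [x0]. A single [d] is both
    radius and slope, because the covering argument of [chord_arc] works with one function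
    [delta]. *)
Lemma diagonal_chord_bound (f : R -> R) x0 :
  (forall z, ex_derive f z) -> continuous (Derive f) x0 -> Derive f x0 <> 0 ->
  exists d, 0 < d /\ forall x y, Rabs (x - x0) < d -> Rabs (y - x0) < d ->
    d * Rabs (x - y) <= Rabs (f x - f y).
Proof.
  intros Hf Hc H0. set (s := Rabs (Derive f x0) / 2).
  assert (Hs : 0 < s) by (generalize (Rabs_pos_lt _ H0); unfold s; lra).
  destruct (proj1 (filterlim_locally (U := R_UniformSpace) _ _) Hc (mkposreal s Hs)) as [d Hd].
  exists (Rmin d s). split; [apply Rmin_pos; [apply cond_pos|exact Hs]|].
  intros x y Hx Hy.
  assert (Hx' := Rlt_le_trans _ _ _ Hx (Rmin_l _ _)).
  assert (Hy' := Rlt_le_trans _ _ _ Hy (Rmin_l _ _)).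
  destruct (mean_value f y x Hf) as [c [Hcc ->]].
  assert (Hcd : Rabs (c - x0) < d).
  { apply Rabs_def2 in Hx'. apply Rabs_def2 in Hy'.
    apply Rabs_def1; revert Hcc; unfold Rmin, Rmax; destruct (Rle_dec y x); lra. }
  specialize (Hd c Hcd). change (Rabs (Derive f c - Derive f x0) < s) in Hd.
  rewrite Rabs_mult. apply Rmult_le_compat_r; [apply Rabs_pos|].
  eapply Rle_trans; [apply Rmin_r|].
  generalize (Rabs_triang (Derive f x0 - Derive f c) (Derive f c)).
  replace (Derive f x0 - Derive f c + Derive f c) with (Derive f x0) by ring.
  rewrite (Rabs_minus_sym (Derive f x0)). unfold s in *. lra.
Qed.

(** Compactness over pairs of parameters. Near the diagonal the nonzero derivative gives the bound,
    away from it injectivity gives a positive distance; [L < 2 * PI] keeps clear of pairs a full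
    period apart, where the chord vanishes again. *)
Lemma chord_arc (L : R) : L < 2 * PI -> exists c, 0 < c /\
  forall x y, Rabs (x - y) <= L -> c * Rabs (x - y) <= Cmod (gam x - gam y).
Proof.
  intros HL. assert (HPI := PI_RGT_0).
  destruct (Rlt_dec L 0) as [HL0|HL0].
  { exists 1. split; [lra|]. intros x y H. generalize (Rabs_pos (x - y)). lra. }
  assert (Hloc : forall x0 y0, exists d : posreal, forall x y,
    Rabs (x - x0) < d -> Rabs (y - y0) < d -> Rabs (x - y) <= L ->
    d * Rabs (x - y) <= Cmod (gam x - gam y)).
  { intros x0 y0. destruct (Req_dec x0 y0) as [<-|Hne].
    - assert (Hr := contour_regular _ Hgam x0).
      destruct (Req_dec (Derive (fun x => Re (gam x)) x0) 0) as [E|E];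
        [destruct (Req_dec (Derive (fun x => Im (gam x)) x0) 0) as [E'|E']|].
      + exfalso. apply Hr. unfold dgam. rewrite E, E'. reflexivity.
      + destruct (diagonal_chord_bound _ x0 ex_derive_Im_gam
            (proj2 (proj1 (continuous_C_iff _ _) (continuous_dgam x0))) E')
          as [d [Hd H]].
        exists (mkposreal d Hd). intros x y Hx Hy _.
        eapply Rle_trans; [exact (H x y Hx Hy)|]. apply (im_le_Cmod (gam x - gam y)).
      + destruct (diagonal_chord_bound _ x0 ex_derive_Re_gam
            (proj1 (proj1 (continuous_C_iff _ _) (continuous_dgam x0))) E)
          as [d [Hd H]].
        exists (mkposreal d Hd). intros x y Hx Hy _.
        eapply Rle_trans; [exact (H x y Hx Hy)|]. apply (re_le_Cmod (gam x - gam y)).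
    - destruct (Rle_dec (2 * PI) (Rabs (x0 - y0))) as [Hfar|Hnear].
      (* No pair within this radius satisfies [Rabs (x - y) <= L]. *)
      + assert (Hd : 0 < (2 * PI - L) / 2) by lra.
        exists (mkposreal _ Hd). simpl. intros x y Hx Hy Hxy. exfalso.
        generalize (Rabs_triang (x0 - x) (x - y)), (Rabs_triang (x0 - y) (y - y0)).
        replace (x0 - x + (x - y)) with (x0 - y) by ring.
        replace (x0 - y + (y - y0)) with (x0 - y0) by ring.
        rewrite (Rabs_minus_sym x0 x). lra.
      + assert (Hp : 0 < Cmod (gam x0 - gam y0)).
        { apply Cmod_gt_0. intros E. apply Hne. apply gam_injective; [|lra].
          now apply Ceq_minus. }
        set (p := Cmod (gam x0 - gam y0)) in *.
        destruct gam_lipschitz as [B [HB [HLip _]]].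
        (* The first term moves each point by at most [p / 4], leaving a chord of at least [p / 2];
           the second keeps the slope times [L] below that. *)
        assert (Hd : 0 < Rmin (p / (4 * B)) (p / (2 * (L + 1)))).
        { apply Rmin_pos; apply Rdiv_lt_0_compat; lra. }
        exists (mkposreal _ Hd). simpl. intros x y Hx Hy Hxy.
        assert (Hx' := Rlt_le_trans _ _ _ Hx (Rmin_l _ _)).
        assert (Hy' := Rlt_le_trans _ _ _ Hy (Rmin_l _ _)).
        assert (Hg : p / 2 <= Cmod (gam x - gam y)).
        { generalize (Cmod_minus_triangle (gam x0) (gam x) (gam y0)),
            (Cmod_minus_triangle (gam x) (gam y) (gam y0)), (HLip x x0), (HLip y y0).
          rewrite (Cmod_minus_sym (gam x0) (gam x)). fold p.
          assert (B * Rabs (x - x0) <= B * (p / (4 * B))) by (apply Rmult_le_compat_l; lra).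
          assert (B * Rabs (y - y0) <= B * (p / (4 * B))) by (apply Rmult_le_compat_l; lra).
          replace (B * (p / (4 * B))) with (p / 4) in * by (field; lra). lra. }
        eapply Rle_trans; [|exact Hg].
        apply Rle_trans with (p / (2 * (L + 1)) * (L + 1)).
        * apply Rmult_le_compat; [lra|apply Rabs_pos|apply Rmin_r|lra].
        * right. field. lra. }
  set (delta := fun x0 y0 => epsilon (inhabits (mkposreal 1 Rlt_0_1))
    (fun d : posreal => forall x y,
    Rabs (x - x0) < d -> Rabs (y - y0) < d -> Rabs (x - y) <= L ->
    d * Rabs (x - y) <= Cmod (gam x - gam y))).
  assert (Hdelta : forall x0 y0 x y, Rabs (x - x0) < delta x0 y0 ->
     Rabs (y - y0) < delta x0 y0 -> Rabs (x - y) <= L ->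
     delta x0 y0 * Rabs (x - y) <= Cmod (gam x - gam y)).
  { intros x0 y0. unfold delta. apply epsilon_spec. apply Hloc. }
  (* After a common shift [x] lies in [0, 2 PI] and [y] within [L] of it, so this box contains a
     representative of every pair. *)
  destruct (compactness_value_2d 0 (2 * PI) (-L) (2 * PI + L) delta) as [c Hc].
  exists c. split; [apply cond_pos|]. intros x y Hxy.
  destruct (shift_into_period 0 x) as [n Hn].
  rewrite <- (gam_shift n x), <- (gam_shift n y).
  replace (x - y) with ((x + IZR n * (2 * PI)) - (y + IZR n * (2 * PI))) in * by ring.
  set (x' := x + IZR n * (2 * PI)) in *. set (y' := y + IZR n * (2 * PI)) in *.
  assert (Hb := Rabs_le_between (x' - y') L).
  destruct (NNPP _ (Hc x' y' ltac:(lra) ltac:(lra))) as [u [v [_ [_ [Hu [Hv Hd]]]]]].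
  eapply Rle_trans; [|apply (Hdelta u v); assumption].
  apply Rmult_le_compat_r; [apply Rabs_pos|exact Hd].
Qed.

(** [1 <= Dm] is what [Rpower_le_lower_exponent] asks of its bound. *)
Lemma gam_diameter : exists Dm, 1 <= Dm /\ forall x y, Cmod (gam x - gam y) <= Dm.
Proof.
  assert (HPI := PI_RGT_0). destruct gam_lipschitz as [B [HB [HLip _]]].
  exists (B * (2 * PI) + 1). split; [nra|].
  intros x y. destruct (shift_into_period y x) as [n Hn].
  rewrite <- (gam_shift n x). eapply Rle_trans; [apply HLip|].
  rewrite Rabs_pos_eq by lra. nra.
Qed.

End Contour.

(** * The integral operator *)

Notation is_CInt := (is_RInt (V := C_R_CompleteNormedModule)).
Notation ex_CInt := (ex_RInt (V := C_R_CompleteNormedModule)).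
Notation CInt := (RInt (V := C_R_CompleteNormedModule)).
Notation Ccontinuous := (continuous (T := R_UniformSpace) (U := C_UniformSpace)).

Lemma C_R_norm (z : C) : norm (V := C_R_CompleteNormedModule) z = Cmod z.
Proof.
  destruct z as [a b].
  change (sqrt (Rabs a ^ 2 + Rabs b ^ 2) = sqrt (a ^ 2 + b ^ 2)).
  now rewrite !pow2_abs.
Qed.

Lemma is_CInt_plus (f g : R -> C) a b (p q : C) :
  is_CInt f a b p -> is_CInt g a b q -> is_CInt (fun x => f x + g x)%C a b (p + q)%C.
Proof. intros. now apply (is_RInt_plus (V := C_R_CompleteNormedModule)). Qed.

(** [C_R_CompleteNormedModule] has only real scalars, so a complex factor goes through real and
    imaginary parts. *)
Lemma is_CInt_scal (c : C) (f : R -> C) a b (l : C) :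
  is_CInt f a b l -> is_CInt (fun x => c * f x)%C a b (c * l)%C.
Proof.
  intros H.
  assert (H1 := is_RInt_fct_extend_fst (U := R_NormedModule) (V := R_NormedModule) _ _ _ _ H).
  assert (H2 := is_RInt_fct_extend_snd (U := R_NormedModule) (V := R_NormedModule) _ _ _ _ H).
  apply (is_RInt_fct_extend_pair (U := R_NormedModule) (V := R_NormedModule)).
  - apply (is_RInt_minus (V := R_NormedModule) (fun x => fst c * fst (f x))
             (fun x => snd c * snd (f x)));
      now apply (is_RInt_scal (V := R_NormedModule)).
  - apply (is_RInt_plus (V := R_NormedModule) (fun x => fst c * snd (f x))
             (fun x => snd c * fst (f x)));
      now apply (is_RInt_scal (V := R_NormedModule)).
Qed.

Lemma is_CInt_ext (f g : R -> C) a b (l : C) :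
  (forall x, f x = g x) -> is_CInt f a b l -> is_CInt g a b l.
Proof.
  intros E. apply (is_RInt_ext (V := C_R_CompleteNormedModule)). intros x _. apply E.
Qed.

Lemma ex_CInt_ext (f g : R -> C) a b :
  (forall x, f x = g x) -> ex_CInt f a b -> ex_CInt g a b.
Proof. intros E [l H]. exists l. now apply (is_CInt_ext f). Qed.

Lemma CInt_ext (f g : R -> C) a b : (forall x, f x = g x) -> CInt f a b = CInt g a b.
Proof.
  intros E. apply (RInt_ext (V := C_R_CompleteNormedModule)). intros x _. apply E.
Qed.

Lemma is_CInt_minus (f g : R -> C) a b (p q : C) :
  is_CInt f a b p -> is_CInt g a b q -> is_CInt (fun x => f x - g x)%C a b (p - q)%C.
Proof. intros. now apply (is_RInt_minus (V := C_R_CompleteNormedModule)). Qed.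

Lemma is_CInt_bound (f : R -> C) a b M (l : C) :
  a <= b -> (forall x, a <= x <= b -> Cmod (f x) <= M) -> is_CInt f a b l ->
  Cmod l <= (b - a) * M.
Proof.
  intros Hab HM Hl. rewrite <- C_R_norm.
  apply (norm_RInt_le_const (V := C_R_CompleteNormedModule) f a b l M Hab); [|exact Hl].
  intros x Hx. rewrite C_R_norm. auto.
Qed.

Lemma CInt_correct (f : R -> C) a b : ex_CInt f a b -> is_CInt f a b (CInt f a b).
Proof. apply (RInt_correct (V := C_R_CompleteNormedModule)). Qed.

Lemma CInt_unique (f : R -> C) a b (l : C) : is_CInt f a b l -> CInt f a b = l.
Proof. apply (is_RInt_unique (V := C_R_CompleteNormedModule)). Qed.

Lemma ex_CInt_continuous (f : R -> C) a b :
  (forall x, Ccontinuous f x) -> ex_CInt f a b.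
Proof. intros H. apply (ex_RInt_continuous (V := C_R_CompleteNormedModule)). intros; apply H. Qed.

(** Only [kap] is frozen at the left end of each piece, while [w] is integrated exactly. The error
    depends on [w] through [W] alone, which becomes an operator-norm bound when [w] varies. *)
Lemma riemann_product_error (kap w : R -> C) (h eps W : R) (n : nat) :
  0 < h -> 0 <= eps -> (forall x, Ccontinuous kap x) -> (forall x, Ccontinuous w x) ->
  (forall x y, Rabs (x - y) <= h -> Cmod (kap x - kap y) <= eps) ->
  (forall x, Cmod (w x) <= W) ->
  Cmod (CInt (fun x => kap x * w x)%C 0 (INR n * h)
        - lsum (seq 0 n) (fun i => CInt w (INR i * h) (INR (S i) * h) * kap (INR i * h)%R)%C)
  <= INR n * h * (eps * W).
Proof.
  intros Hh Heps Hkap Hw Hk HW. induction n as [|n IH].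
  - simpl. rewrite Rmult_0_l.
    replace (CInt (fun x => kap x * w x)%C 0 0) with (RtoC 0)
      by (symmetry; apply (RInt_point (V := C_R_CompleteNormedModule))).
    replace (0 - 0)%C with (RtoC 0) by ring. rewrite Cmod_0. lra.
  - rewrite seq_S, lsum_app. cbn [Nat.add lsum fold_right].
    set (x := INR n * h) in *.
    assert (Hx : INR (S n) * h = x + h) by (rewrite S_INR; unfold x; ring).
    rewrite Hx.
    assert (Hex : forall a b, ex_CInt (fun x => kap x * w x)%C a b).
    { intros. apply ex_CInt_continuous. intros. now apply continuous_C_mult. }
    rewrite <- (RInt_Chasles (V := C_R_CompleteNormedModule) _ 0 x (x + h)) by apply Hex.
    change (plus (CInt (fun x => kap x * w x)%C 0 x) (CInt (fun x => kap x * w x)%C x (x + h)))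
      with (CInt (fun x => kap x * w x)%C 0 x + CInt (fun x => kap x * w x)%C x (x + h))%C.
    set (s := lsum (seq 0 n) _) in *.
    assert (Hp : Cmod (CInt (fun x => kap x * w x)%C x (x + h) - kap x * CInt w x (x + h))%C
                 <= (x + h - x) * (eps * W)).
    { apply (is_CInt_bound (fun y => kap y * w y - kap x * w y)%C).
      - lra.
      - intros y Hy. replace (kap y * w y - kap x * w y)%C with ((kap y - kap x) * w y)%C by ring.
        rewrite Cmod_mult. apply Rmult_le_compat; try apply Cmod_ge_0; [|apply HW].
        apply Hk. rewrite Rabs_pos_eq; lra.
      - apply is_CInt_minus; [apply CInt_correct, Hex|].
        apply is_CInt_scal. apply CInt_correct, ex_CInt_continuous, Hw. }
    assert (Hsplit : forall p q s' a b : C,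
       (p + q - (s' + (a * b + 0)))%C = ((p - s') + (q - b * a))%C) by (intros; ring).
    rewrite Hsplit.
    eapply Rle_trans; [apply Cmod_triangle|].
    replace ((x + h) * (eps * W)) with (x * (eps * W) + (x + h - x) * (eps * W)) by ring.
    now apply Rplus_le_compat.
Qed.

(** Continuity on the curve, read in the parameter; this is the space in which the Fredholm
    alternative is applied. *)
Definition pullback_continuous (gam : R -> C) (v : C -> C) : Prop :=
  forall th, Ccontinuous (fun x => v (gam x)) th.

(** The continuous weights [h] absorb the kernel section and [dgam], so that a condition on [v]
    alone can be passed around. *)
Definition integrable (gam : R -> C) (v : C -> C) : Prop :=
  forall h : R -> C, (forall th, Ccontinuous h th) ->
    ex_CInt (fun th => h th * v (gam th))%C 0 (2 * PI).

Lemma on_curve_gam (gam : R -> C) th : on_curve gam (gam th).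
Proof. now exists th. Qed.

Lemma integrable_lin gam (a : C) v w : integrable gam v -> integrable gam w ->
  integrable gam (fun t => a * v t + w t)%C.
Proof.
  intros Hv Hw h Hh. destruct (Hv h Hh) as [p Hp]. destruct (Hw h Hh) as [q Hq].
  exists (a * p + q)%C.
  apply (is_CInt_ext
           (fun th => a * (h th * v (gam th)) + h th * w (gam th))%C).
  - intros. ring.
  - apply is_CInt_plus; [now apply is_CInt_scal|exact Hq].
Qed.

Lemma integrable_pullback_continuous gam v : pullback_continuous gam v -> integrable gam v.
Proof. intros H h Hh. apply ex_CInt_continuous. intros. apply continuous_C_mult; auto. Qed.

Lemma integrable_ext gam v w : eq_on (on_curve gam) v w -> integrable gam v -> integrable gam w.
Proof.
  intros E H h Hh. apply (ex_CInt_ext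
    (fun th => h th * v (gam th))%C).
  - intros x. now rewrite (E _ (on_curve_gam gam x)).
  - now apply H.
Qed.

Section Operator.

Context {gam : R -> C} (Hgam : is_contour gam).
Context {mu : R} {k : C -> C -> C} (Hmu0 : 0 < mu) (Hk : kernel_regular gam mu k).

Lemma pullback_function_space : function_space (on_curve gam) (pullback_continuous gam).
Proof.
  assert (HPI := PI_RGT_0). split.
  - intros th. apply continuous_C_const.
  - intros a v w Hv Hw th. apply continuous_C_plus; [|apply Hw].
    apply continuous_C_mult; [apply continuous_C_const|apply Hv].
  - intros v Hv.
    destruct (R_continuous_bounded (fun th => Cmod (v (gam th))) 0 (2 * PI)) as [B HB].
    + lra.
    + intros x. apply continuous_R_Cmod, Hv.
    + exists B. intros t [th <-]. destruct (shift_into_period 0 th) as [n Hn].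
      rewrite <- (gam_shift Hgam n). apply HB. lra.
  - intros v Hv th. apply continuous_Cmod. intros eps Heps.
    destruct (Hv (eps / 4)) as [w [Hw Hvw]]; [lra|].
    destruct (proj1 (continuous_Cmod _ _) (Hw th) (eps / 4)) as [d [Hd Hdd]]; [lra|].
    exists d. split; [exact Hd|]. intros y Hy.
    generalize (Hdd y Hy), (Hvw _ (on_curve_gam gam y)), (Hvw _ (on_curve_gam gam th)),
      (Cmod_minus_triangle (v (gam y)) (w (gam y)) (v (gam th))),
      (Cmod_minus_triangle (w (gam y)) (w (gam th)) (v (gam th))).
    rewrite (Cmod_minus_sym (w (gam th))). lra.
Qed.

(** Uniformity in [t] is what makes the remainder of the finite-rank splitting small in operator
    norm. *)
Lemma kernel_equicontinuous (eps : R) : 0 < eps -> exists d, 0 < d /\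
  forall t x y, on_curve gam t -> Rabs (x - y) < d ->
    Cmod (k t (gam x) - k t (gam y)) <= eps.
Proof.
  intros Heps. destruct Hk as [M0 [Mmu [omega [_ [_ [Hom Hom2]]]]]].
  destruct (proj1 (filterlim_locally _ _) Hom (mkposreal eps Heps)) as [d Hd].
  destruct (gam_lipschitz Hgam) as [B [HB [HL _]]].
  exists (d / B). split; [apply Rdiv_lt_0_compat; [apply cond_pos|lra]|].
  intros t x y Ht Hxy.
  (* [omega] is controlled only to the right of 0, so coinciding points are treated apart. *)
  destruct (classic (gam x = gam y)) as [->|Hne].
  { replace (k t (gam y) - k t (gam y))%C with (RtoC 0) by ring. rewrite Cmod_0. lra. }
  eapply Rle_trans; [apply Hom2; auto using on_curve_gam|].
  assert (Hpos : 0 < Cmod (gam x - gam y)).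
  { apply Cmod_gt_0. intros E. now apply Hne, Ceq_minus. }
  assert (Hlt : Cmod (gam x - gam y) < d).
  { eapply Rle_lt_trans; [apply HL|]. apply Rlt_div_r in Hxy; lra. }
  assert (H : Rabs (omega (Cmod (gam x - gam y)) - 0) < eps).
  { apply Hd; [|exact Hpos]. change (Rabs (Cmod (gam x - gam y) - 0) < d).
    rewrite Rminus_0_r, Rabs_pos_eq; lra. }
  apply Rabs_def2 in H. lra.
Qed.

Lemma kernel_continuous t : on_curve gam t -> pullback_continuous gam (k t).
Proof.
  intros Ht th. apply continuous_Cmod. intros eps Heps.
  destruct (kernel_equicontinuous (eps / 2)) as [d [Hd H]]; [lra|].
  exists d. split; [exact Hd|]. intros y Hy. specialize (H t y th Ht Hy). lra.
Qed.

Lemma Kop_integral v t : integrable gam v -> on_curve gam t ->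
  is_CInt (fun th => k t (gam th) * v (gam th) * dgam gam th)%C 0 (2 * PI) (Kop gam k v t).
Proof.
  intros Hv Ht. apply CInt_correct.
  apply (ex_CInt_ext
           (fun th => (k t (gam th) * dgam gam th) * v (gam th))%C).
  - intros. ring.
  - apply Hv. intros th. apply continuous_C_mult.
    + now apply kernel_continuous.
    + now apply continuous_dgam.
Qed.

Lemma Kop_lin (a : C) v w t : integrable gam v -> integrable gam w -> on_curve gam t ->
  Kop gam k (fun s => a * v s + w s)%C t = (a * Kop gam k v t + Kop gam k w t)%C.
Proof.
  intros Hv Hw Ht. apply CInt_unique.
  apply (is_CInt_ext
    (fun th => a * (k t (gam th) * v (gam th) * dgam gam th)
               + k t (gam th) * w (gam th) * dgam gam th)%C).
  - intros. ring.
  - apply is_CInt_plus; [apply is_CInt_scal|]; now apply Kop_integral.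
Qed.

Lemma Kop_ext v w t : eq_on (on_curve gam) v w -> Kop gam k v t = Kop gam k w t.
Proof.
  intros E. apply CInt_ext.
  intros x. now rewrite (E _ (on_curve_gam gam x)).
Qed.

(** The regularity of the kernel in [t] passes through the integral, and [v] enters only by its
    bound: this is the smoothing by K. *)
Lemma Kop_bounds : exists c, 0 < c /\ forall v M, integrable gam v ->
  (forall t, on_curve gam t -> Cmod (v t) <= M) ->
  (forall t, on_curve gam t -> Cmod (Kop gam k v t) <= c * M) /\
  (forall t s, on_curve gam t -> on_curve gam s -> t <> s ->
     Cmod (Kop gam k v t - Kop gam k v s) <= c * M * Rpower (Cmod (t - s)) mu).
Proof.
  assert (HPI := PI_RGT_0).
  destruct Hk as [M0 [Mmu [omega [H0 [H1 _]]]]].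
  destruct (gam_lipschitz Hgam) as [B [HB [_ HdB]]].
  (* One constant for both estimates; the 1 keeps it positive even for a vanishing kernel. *)
  set (m := Rmax 1 (Rmax M0 Mmu)).
  assert (Hm : 1 <= m) by apply Rmax_l.
  assert (HM0 : M0 <= m) by (eapply Rle_trans; [apply Rmax_l|apply Rmax_r]).
  assert (HMmu : Mmu <= m) by (eapply Rle_trans; [apply Rmax_r|apply Rmax_r]).
  exists (2 * PI * (m * B)). split; [apply Rmult_lt_0_compat; nra|].
  intros v M Hv HM.
  assert (HMp : 0 <= M) by (eapply Rle_trans; [apply Cmod_ge_0|apply (HM _ (on_curve_gam gam 0))]).
  split.
  - intros t Ht. replace (2 * PI * (m * B) * M) with ((2 * PI - 0) * (m * M * B)) by ring.
    apply (is_CInt_bound (fun th => k t (gam th) * v (gam th) * dgam gam th)%C);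
      [lra| |now apply Kop_integral].
    intros x _. rewrite !Cmod_mult.
    apply Rmult_le_compat; [|apply Cmod_ge_0| |apply HdB].
    + apply Rmult_le_pos; apply Cmod_ge_0.
    + apply Rmult_le_compat; try apply Cmod_ge_0; auto using on_curve_gam.
      eapply Rle_trans; [apply H0|]; auto using on_curve_gam.
  - intros t s Ht Hs Hts.
    set (P := Rpower (Cmod (t - s)) mu).
    assert (HP : 0 < P) by apply exp_pos.
    replace (2 * PI * (m * B) * M * P) with ((2 * PI - 0) * (m * P * M * B)) by ring.
    apply (is_CInt_bound (fun th => k t (gam th) * v (gam th) * dgam gam th
                            - k s (gam th) * v (gam th) * dgam gam th)%C);
      [lra| |now apply is_CInt_minus; apply Kop_integral].
    intros x _. replace (k t (gam x) * v (gam x) * dgam gam x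
       - k s (gam x) * v (gam x) * dgam gam x)%C
      with ((k t (gam x) - k s (gam x)) * v (gam x) * dgam gam x)%C by ring.
    rewrite !Cmod_mult.
    apply Rmult_le_compat; [|apply Cmod_ge_0| |apply HdB].
    + apply Rmult_le_pos; apply Cmod_ge_0.
    + apply Rmult_le_compat; try apply Cmod_ge_0; auto using on_curve_gam.
      eapply Rle_trans; [apply H1|]; auto using on_curve_gam.
      apply Rmult_le_compat_r; lra.
Qed.

Lemma Rpower_small (s eps : R) : 0 < s -> 0 < eps ->
  exists d, 0 < d /\ forall r, 0 < r < d -> Rpower r s < eps.
Proof.
  intros Hs He. exists (Rpower eps (/ s)). split; [apply exp_pos|].
  intros r Hr. replace eps with (Rpower (Rpower eps (/ s)) s).
  - apply Rlt_Rpower_l; lra.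
  - rewrite Rpower_mult, Rinv_l, Rpower_1; lra.
Qed.

Lemma holder_pullback_continuous (s : R) (v : C -> C) :
  0 < s -> in_H gam s v -> pullback_continuous gam v.
Proof.
  intros Hs [M HM] th. apply continuous_Cmod. intros eps Heps.
  destruct (Rpower_small s (eps / (Rabs M + 1))) as [d [Hd Hsm]]; [exact Hs| |].
  { apply Rdiv_lt_0_compat; [lra|]. generalize (Rabs_pos M); lra. }
  destruct (gam_lipschitz Hgam) as [B [HB [HL _]]].
  exists (d / B). split; [apply Rdiv_lt_0_compat; lra|]. intros y Hy.
  destruct (classic (gam y = gam th)) as [->|Hne].
  { replace (v (gam th) - v (gam th))%C with (RtoC 0) by ring. rewrite Cmod_0. lra. }
  eapply Rle_lt_trans; [apply HM; auto using on_curve_gam|].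
  assert (Hpos : 0 < Cmod (gam y - gam th)).
  { apply Cmod_gt_0. intros E. now apply Hne, Ceq_minus. }
  assert (Hlt : Cmod (gam y - gam th) < d).
  { eapply Rle_lt_trans; [apply HL|]. apply Rlt_div_r in Hy; lra. }
  assert (HR := Hsm _ (conj Hpos Hlt)).
  assert (0 < Rpower (Cmod (gam y - gam th)) s) by apply exp_pos.
  generalize (Rle_abs M), (Rabs_pos M). intros.
  apply Rlt_div_r in HR; [|lra]. nra.
Qed.

Lemma Kop_holder v : integrable gam v -> (exists M, forall t, on_curve gam t -> Cmod (v t) <= M) ->
  in_H gam mu (Kop gam k v).
Proof.
  intros Hv [M HM]. destruct Kop_bounds as [c [_ Hc]].
  exists (c * M). apply (Hc v M Hv HM).
Qed.

Lemma kernel_section_continuous tau : on_curve gam tau ->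
  pullback_continuous gam (fun t => k t tau).
Proof.
  intros Htau. apply (holder_pullback_continuous mu); [exact Hmu0|].
  destruct Hk as [M0 [Mmu [omega [_ [H1 _]]]]]. exists Mmu.
  intros t r Ht Hr Htr. now apply H1.
Qed.

Lemma fredholm_contour (lam : C)
  (Hinj : forall v, pullback_continuous gam v ->
     (forall t, on_curve gam t -> v t = (lam * Kop gam k v t)%C) ->
     forall t, on_curve gam t -> v t = RtoC 0) :
  exists Cst, forall g M, pullback_continuous gam g ->
    (forall t, on_curve gam t -> Cmod (g t) <= M) ->
    exists u, pullback_continuous gam u /\
      (forall t, on_curve gam t -> u t = (lam * Kop gam k u t + g t)%C) /\
      (forall t, on_curve gam t -> Cmod (u t) <= Cst * M).
Proof.
  assert (HPI := PI_RGT_0). assert (HE := pullback_function_space).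
  destruct (gam_lipschitz Hgam) as [B [HB [_ HdB]]].
  set (la := Cmod lam). assert (Hla : 0 <= la) by apply Cmod_ge_0.
  (* Brings the norm of the remainder down to [la / (2 * (la + 1))], below 1/2; [la + 1] covers
     [lam = 0]. *)
  set (eps := / (2 * (la + 1) * (2 * PI) * B)).
  assert (Heps : 0 < eps).
  { apply Rinv_0_lt_compat. apply Rmult_lt_0_compat; [apply Rmult_lt_0_compat|]; lra. }
  destruct (kernel_equicontinuous eps Heps) as [d [Hd Hkd]].
  destruct (archimed_cor1 (d / (2 * PI))) as [n [Hn Hn0]].
  { apply Rdiv_lt_0_compat; lra. }
  assert (Hn1 : 0 < INR n) by now apply lt_0_INR.
  set (h := 2 * PI / INR n).
  assert (Hh : 0 < h) by (apply Rdiv_lt_0_compat; lra).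
  assert (Hhd : h < d).
  { apply Rlt_div_r in Hn; [|lra]. unfold h, Rdiv. lra. }
  assert (Hnh : INR n * h = 2 * PI) by (unfold h; field; lra).
  set (r := seq 0 n).
  (* The i-th functional integrates [v] over the i-th piece of parameter length [h]; the matching
     section [kk i] is frozen at its left end. *)
  set (l := fun i (v : C -> C) =>
              CInt (fun th => v (gam th) * dgam gam th)%C (INR i * h) (INR (S i) * h)).
  set (kk := fun i t => (lam * k t (gam (INR i * h)%R))%C).
  assert (Hw : forall v, pullback_continuous gam v ->
            forall th, Ccontinuous (fun th => v (gam th) * dgam gam th)%C th).
  { intros v Hv th. apply continuous_C_mult; [apply Hv|now apply continuous_dgam]. }
  assert (Hkk : forall i, pullback_continuous gam (kk i)).
  { intros i. apply (fs_scal HE). apply kernel_section_continuous, on_curve_gam. }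
  assert (Hl : forall i, bounded_functional (on_curve gam) (pullback_continuous gam) (l i) (h * B)).
  { intros i. split.
    - intros a v w Hv Hw'. apply CInt_unique.
      apply (is_CInt_ext
        (fun th => a * (v (gam th) * dgam gam th) + w (gam th) * dgam gam th)%C).
      + intros. ring.
      + apply is_CInt_plus; [apply is_CInt_scal|]; apply CInt_correct, ex_CInt_continuous;
          now apply Hw.
    - intros v M Hv HM.
      replace (h * B * M) with ((INR (S i) * h - INR i * h) * (M * B)) by (rewrite S_INR; ring).
      apply (is_CInt_bound (fun th => v (gam th) * dgam gam th)%C).
      + rewrite S_INR. nra.
      + intros x _. rewrite Cmod_mult.
        apply Rmult_le_compat; try apply Cmod_ge_0; auto using on_curve_gam.
      + apply CInt_correct, ex_CInt_continuous. now apply Hw. }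
  set (S0 := fun (v : C -> C) t => (lam * Kop gam k v t - lsum r (fun i => l i v * kk i t))%C).
  assert (HS : bounded_operator (on_curve gam) (pullback_continuous gam) S0 (/ 2)).
  { split.
    - intros v Hv. apply (fs_minus HE).
      + apply (fs_scal HE). apply (holder_pullback_continuous mu); [exact Hmu0|].
        apply Kop_holder; [now apply integrable_pullback_continuous|].
        now apply (fs_bounded _ _ HE).
      + apply (fs_lsum HE). intros; apply Hkk.
    - intros a v w t Hv Hw' Ht. unfold S0.
      rewrite Kop_lin by auto using integrable_pullback_continuous.
      rewrite (lsum_ext r (fun i => l i (fun s => a * v s + w s) * kk i t)%C
                 (fun i => a * (l i v * kk i t) + l i w * kk i t)%C).
      + rewrite lsum_plus, lsum_scal. ring.
      + intros i _. rewrite (fn_lin _ _ _ _ (Hl i)) by assumption. ring.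
    - intros v M Hv HM t Ht. unfold S0, kk.
      rewrite (lsum_ext r _ (fun i => lam * (l i v * k t (gam (INR i * h)%R)))%C)
        by (intros; ring).
      rewrite lsum_scal.
      match goal with |- Cmod (lam * ?a - lam * ?b) <= _ =>
        replace (lam * a - lam * b)%C with (lam * (a - b))%C by ring end.
      rewrite Cmod_mult. fold la.
      (* [v] is grouped with [dgam], so that only the kernel is frozen. *)
      replace (Kop gam k v t)
        with (CInt (fun x => k t (gam x) * (v (gam x) * dgam gam x))%C 0 (INR n * h)).
      2:{ rewrite Hnh. apply CInt_ext.
          intros. apply Cmult_assoc. }
      assert (HMp : 0 <= M)
        by (eapply Rle_trans; [apply Cmod_ge_0|apply (HM _ Ht)]).
      eapply Rle_trans.
      + apply Rmult_le_compat_l; [exact Hla|].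
        apply (riemann_product_error (fun x => k t (gam x))
                 (fun x => v (gam x) * dgam gam x)%C h eps (M * B)).
        * exact Hh.
        * lra.
        * now apply kernel_continuous.
        * now apply Hw.
        * intros x y Hxy. apply Hkd; [exact Ht|lra].
        * intros x. rewrite Cmod_mult.
          apply Rmult_le_compat; try apply Cmod_ge_0; auto using on_curve_gam.
      + rewrite Hnh.
        replace (la * (2 * PI * (eps * (M * B)))) with (la / (2 * (la + 1)) * M)
          by (unfold eps; field; lra).
        apply Rmult_le_compat_r; [exact HMp|].
        apply Rle_div_l; lra. }
  assert (Hsplit : forall v t, (lam * Kop gam k v t)%C
            = (S0 v t + lsum r (fun i => l i v * kk i t))%C) by (intros; unfold S0; ring).
  destruct (fredholm HE HS ltac:(lra) ltac:(lra) r kk l (h * B)) as [Cst HC].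
  - apply seq_NoDup.
  - intros; apply Hkk.
  - intros; apply Hl.
  - intros v Hv Heq. apply Hinj; [exact Hv|]. intros t Ht. rewrite Hsplit. auto.
  - exists Cst. intros g M Hg HM. destruct (HC g M Hg HM) as [u [Hu [Hueq Hub]]].
    exists u. split; [exact Hu|]. split; [|exact Hub].
    intros t Ht. rewrite Hsplit. auto.
Qed.

End Operator.

(** * Piecewise Hölder functions *)

Lemma right_limit_iff (f : R -> C) (a : R) (l : C) :
  filterlim f (at_right a) (locally (T := C_UniformSpace) l) <->
  forall eps, 0 < eps -> exists d, 0 < d /\ forall y, a < y < a + d -> Cmod (f y - l) < eps.
Proof.
  rewrite filterlim_Cmod. split; intros H eps Heps; destruct (H eps Heps) as [d Hd].
  - exists d. split; [apply cond_pos|]. intros y Hy. apply Hd; [|lra].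
    change (Rabs (y - a) < d). rewrite Rabs_pos_eq; lra.
  - destruct Hd as [Hd Hy]. exists (mkposreal d Hd). intros y Hyd Hay. apply Hy.
    change (Rabs (y - a) < d) in Hyd. apply Rabs_def2 in Hyd. lra.
Qed.

Lemma left_limit_iff (f : R -> C) (a : R) (l : C) :
  filterlim f (at_left a) (locally (T := C_UniformSpace) l) <->
  forall eps, 0 < eps -> exists d, 0 < d /\ forall y, a - d < y < a -> Cmod (f y - l) < eps.
Proof.
  rewrite filterlim_Cmod. split; intros H eps Heps; destruct (H eps Heps) as [d Hd].
  - exists d. split; [apply cond_pos|]. intros y Hy. apply Hd; [|lra].
    change (Rabs (y - a) < d). rewrite Rabs_left; lra.
  - destruct Hd as [Hd Hy]. exists (mkposreal d Hd). intros y Hyd Hay. apply Hy.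
    change (Rabs (y - a) < d) in Hyd. apply Rabs_def2 in Hyd. lra.
Qed.

Lemma Rpower_pos r s : 0 < Rpower r s.
Proof. apply exp_pos. Qed.

(** With [s' - s <= 1], the factor [L] to the power s' - s is at most [L] itself. *)
Lemma Rpower_le_lower_exponent (r L s s' : R) :
  0 < r <= L -> 1 <= L -> s <= s' -> s' - s <= 1 -> Rpower r s' <= L * Rpower r s.
Proof.
  intros Hr HL Hs Hs'. replace s' with ((s' - s) + s) by ring. rewrite Rpower_plus.
  apply Rmult_le_compat_r; [left; apply Rpower_pos|].
  eapply Rle_trans; [apply (Rle_Rpower_l r L); lra|].
  rewrite <- (Rpower_1 L) at 2 by lra. apply Rle_Rpower; lra.
Qed.

(** The distance is that of the parameter, so gluing and completion need no geometry of the
    curve. *)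
Definition holder_on (s M a b : R) (f : R -> C) : Prop :=
  forall x y, a <= x <= b -> a <= y <= b -> x <> y ->
    Cmod (f x - f y) <= M * Rpower (Rabs (x - y)) s.

Lemma holder_on_of_lt s M a b (f : R -> C) :
  (forall x y, a <= x -> x < y -> y <= b -> Cmod (f x - f y) <= M * Rpower (y - x) s) ->
  holder_on s M a b f.
Proof.
  intros H x y Hx Hy Hxy. destruct (Rdichotomy x y Hxy) as [Hlt|Hlt].
  - rewrite Rabs_left by lra. replace (- (x - y)) with (y - x) by ring. apply H; lra.
  - rewrite Rabs_pos_eq, Cmod_minus_sym by lra. apply H; lra.
Qed.

(** A pair separated by [b] is compared through [b]; both partial distances are at most the whole
    one. *)
Lemma holder_on_glue s M1 M2 a b c (f : R -> C) :
  0 < s -> 0 <= M1 -> 0 <= M2 -> a <= b <= c ->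
  holder_on s M1 a b f -> holder_on s M2 b c f -> holder_on s (M1 + M2) a c f.
Proof.
  intros Hs HM1 HM2 Habc H1 H2. apply holder_on_of_lt. intros x y Hx Hxy Hy.
  assert (Hp := Rpower_pos (y - x) s).
  destruct (Rle_dec y b) as [Hyb|Hyb]; [|destruct (Rle_dec b x) as [Hbx|Hbx]].
  - generalize (H1 x y ltac:(lra) ltac:(lra) ltac:(lra)).
    rewrite Rabs_left by lra. replace (- (x - y)) with (y - x) by ring. nra.
  - generalize (H2 x y ltac:(lra) ltac:(lra) ltac:(lra)).
    rewrite Rabs_left by lra. replace (- (x - y)) with (y - x) by ring. nra.
  - generalize (H1 x b ltac:(lra) ltac:(lra) ltac:(lra)), (H2 b y ltac:(lra) ltac:(lra) ltac:(lra)),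
      (Cmod_minus_triangle (f x) (f b) (f y)).
    rewrite 2!Rabs_left by lra.
    assert (Rpower (- (x - b)) s <= Rpower (y - x) s) by (apply Rle_Rpower_l; lra).
    assert (Rpower (- (b - y)) s <= Rpower (y - x) s) by (apply Rle_Rpower_l; lra).
    nra.
Qed.

(** Endpoints are approached from inside, with the approximating pair kept between [x] and [y], so
    the constant [M] survives. *)
Lemma holder_completion s M a b (f g : R -> C) :
  0 < s -> 0 <= M -> a < b ->
  (forall x y, a < x < b -> a < y < b -> x <> y ->
     Cmod (f x - f y) <= M * Rpower (Rabs (x - y)) s) ->
  (forall x, a < x < b -> g x = f x) ->
  filterlim f (at_right a) (locally (T := C_UniformSpace) (g a)) ->
  filterlim f (at_left b) (locally (T := C_UniformSpace) (g b)) ->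
  holder_on s M a b g.
Proof.
  intros Hs HM Hab Hf Hg Ha Hb.
  assert (Ha' := proj1 (right_limit_iff f a (g a)) Ha).
  assert (Hb' := proj1 (left_limit_iff f b (g b)) Hb).
  apply holder_on_of_lt. intros x y Hx Hxy Hy.
  apply le_epsilon. intros eps Heps.
  (* The midpoint separates x' from y', which keeps them distinct and ordered. *)
  assert (Hx' : exists x', a < x' < b /\ x <= x' < (x + y) / 2 /\ Cmod (f x' - g x) < eps / 2).
  { destruct (Req_dec a x) as [<-|Hax].
    - destruct (Ha' (eps / 2)) as [d [Hd H]]; [lra|].
      set (e := Rmin (d / 2) ((y - a) / 4)).
      assert (0 < e) by (apply Rmin_pos; lra).
      assert (e <= d / 2) by apply Rmin_l. assert (e <= (y - a) / 4) by apply Rmin_r.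
      exists (a + e). split; [lra|]. split; [lra|]. apply H. lra.
    - exists x. split; [lra|]. split; [lra|]. rewrite Hg by lra.
      replace (f x - f x)%C with (RtoC 0) by ring. rewrite Cmod_0. lra. }
  assert (Hy' : exists y', a < y' < b /\ (x + y) / 2 < y' <= y /\ Cmod (f y' - g y) < eps / 2).
  { destruct (Req_dec y b) as [->|Hyb].
    - destruct (Hb' (eps / 2)) as [d [Hd H]]; [lra|].
      set (e := Rmin (d / 2) ((b - x) / 4)).
      assert (0 < e) by (apply Rmin_pos; lra).
      assert (e <= d / 2) by apply Rmin_l. assert (e <= (b - x) / 4) by apply Rmin_r.
      exists (b - e). split; [lra|]. split; [lra|]. apply H. lra.
    - exists y. split; [lra|]. split; [lra|]. rewrite Hg by lra.
      replace (f y - f y)%C with (RtoC 0) by ring. rewrite Cmod_0. lra. }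
  destruct Hx' as [x' [Hx1 [Hx2 Hx3]]]. destruct Hy' as [y' [Hy1 [Hy2 Hy3]]].
  generalize (Hf x' y' Hx1 Hy1 ltac:(lra)), (Cmod_minus_triangle (g x) (f x') (g y)),
    (Cmod_minus_triangle (f x') (f y') (g y)).
  rewrite (Cmod_minus_sym (g x) (f x')), Rabs_left by lra.
  assert (Rpower (- (x' - y')) s <= Rpower (y - x) s) by (apply Rle_Rpower_l; lra).
  nra.
Qed.

(** [0 <= b] covers the empty set, where [Lub_Rbar] is minus infinity and [real] returns 0. *)
Lemma rsup_le (S : R -> Prop) (b : R) : 0 <= b -> (forall r, S r -> r <= b) -> rsup S <= b.
Proof.
  intros Hb H. unfold rsup. destruct (Lub_Rbar_correct S) as [_ Hl].
  specialize (Hl (Finite b)). destruct (Lub_Rbar S) as [l| |]; simpl.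
  - apply Hl. intros r Hr. now apply H.
  - exfalso. apply Hl. intros r Hr. now apply H.
  - exact Hb.
Qed.

Lemma le_rsup (S : R -> Prop) (b r : R) : (forall r, S r -> r <= b) -> S r -> r <= rsup S.
Proof.
  intros H Hr. unfold rsup. destruct (Lub_Rbar_correct S) as [Hu Hl].
  specialize (Hl (Finite b) H). specialize (Hu r Hr).
  destruct (Lub_Rbar S) as [l| |]; simpl in *; tauto.
Qed.

Lemma fold_right_Rmax_ge (l : list R) (x : R) : In x l -> x <= fold_right Rmax 0 l.
Proof.
  induction l as [|a l IH]; simpl; [tauto|]. intros [->|Hx].
  - apply Rmax_l.
  - eapply Rle_trans; [now apply IH|apply Rmax_r].
Qed.

(** * Continuity arcs, lateral values and the norm of X *)

Section Discontinuities.

Context {gam : R -> C} (Hgam : is_contour gam).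
Context {nd : nat} {thd : nat -> R} (Hdisc : is_disc nd thd).

Lemma thd_lt i j : (1 <= i)%nat -> (i < j)%nat -> (j <= nd)%nat -> thd i < thd j.
Proof.
  intros Hi Hij. induction Hij as [|j Hij IH]; intros Hj.
  - apply (disc_incr _ _ Hdisc). lia.
  - eapply Rlt_trans; [apply IH; lia|]. apply (disc_incr _ _ Hdisc). lia.
Qed.

Lemma thd_le i j : (1 <= i)%nat -> (i <= j)%nat -> (j <= nd)%nat -> thd i <= thd j.
Proof.
  intros Hi Hij Hj. destruct (Nat.eq_dec i j) as [<-|]; [lra|].
  left. apply thd_lt; lia.
Qed.

Lemma thd_range j : (1 <= j <= nd)%nat -> 0 < thd j < 2 * PI.
Proof.
  intros Hj. generalize (thd_le 1 j ltac:(lia) ltac:(lia) ltac:(lia)),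
    (thd_le j nd ltac:(lia) ltac:(lia) ltac:(lia)), (disc_first _ _ Hdisc), (disc_last _ _ Hdisc).
  lra.
Qed.

Lemma arc_r_lt j : (j < nd)%nat -> arc_r nd thd j = thd (S j).
Proof. intros H. unfold arc_r. now rewrite (proj2 (Nat.ltb_lt j nd) H). Qed.

Lemma arc_r_last : arc_r nd thd nd = thd 1%nat + 2 * PI.
Proof. unfold arc_r. now rewrite Nat.ltb_irrefl. Qed.

Lemma arc_length_pos j : (1 <= j <= nd)%nat -> arc_l thd j < arc_r nd thd j.
Proof.
  intros Hj. unfold arc_l. destruct (Nat.eq_dec j nd) as [->|Hne].
  - rewrite arc_r_last. generalize (thd_range nd Hj), (disc_first _ _ Hdisc). lra.
  - rewrite arc_r_lt by lia. apply thd_lt; lia.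
Qed.

Lemma arc_in_period j : (1 <= j <= nd)%nat ->
  thd 1%nat <= arc_l thd j /\ arc_r nd thd j <= thd 1%nat + 2 * PI.
Proof.
  intros Hj. unfold arc_l. split; [apply thd_le; lia|].
  destruct (Nat.eq_dec j nd) as [->|Hne].
  - rewrite arc_r_last. lra.
  - rewrite arc_r_lt by lia.
    generalize (thd_range (S j) ltac:(lia)), (disc_first _ _ Hdisc). lra.
Qed.

(** With at least two arcs none fills a whole period, so one length bound below [2 * PI] serves them
    all; it is the [L] given to [chord_arc]. *)
Lemma arc_length_le j : (1 <= j <= nd)%nat -> nd <> 1%nat ->
  arc_r nd thd j - arc_l thd j
  <= Rmax (thd nd - thd 1%nat) (thd 1%nat + 2 * PI - thd nd) < 2 * PI.
Proof.
  intros Hj Hnd. unfold arc_l. split.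
  - destruct (Nat.eq_dec j nd) as [->|Hne].
    + rewrite arc_r_last. apply Rmax_r.
    + rewrite arc_r_lt by lia. eapply Rle_trans; [|apply Rmax_l].
      generalize (thd_le (S j) nd ltac:(lia) ltac:(lia) ltac:(lia)),
        (thd_le 1 j ltac:(lia) ltac:(lia) ltac:(lia)). lra.
  - generalize (thd_lt 1 nd ltac:(lia) ltac:(lia) ltac:(lia)),
      (disc_first _ _ Hdisc), (disc_last _ _ Hdisc). intros.
    apply Rmax_lub_lt; lra.
Qed.

(** For a single arc the chord vanishes between its two ends, and arc length is compared through the
    extreme speeds; otherwise the chord-arc inequality applies. *)
Lemma arc_dist_equiv : exists c B, 0 < c /\ 0 < B /\ forall j x y, (1 <= j <= nd)%nat ->
  arc_l thd j <= x <= arc_r nd thd j -> arc_l thd j <= y <= arc_r nd thd j ->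
  c * Rabs (x - y) <= arc_dist gam nd x y <= B * Rabs (x - y).
Proof.
  assert (HPI := PI_RGT_0).
  destruct (gam_lipschitz Hgam) as [B [HB [HL HdB]]].
  unfold arc_dist. destruct (Nat.eqb_spec nd 1) as [Hnd|Hnd].
  - destruct (speed_lower_bound Hgam) as [m [Hm Hmd]].
    exists m, B. split; [exact Hm|]. split; [exact HB|].
    intros j x y _ _ _. clear j.
    assert (Hex : forall a b, ex_RInt (fun th => Cmod (dgam gam th)) a b).
    { intros a b. apply (ex_RInt_continuous (V := R_CompleteNormedModule)).
      intros z _. now apply continuous_R_Cmod, continuous_dgam. }
    assert (Hlt : forall a b, a <= b -> m * (b - a) <= RInt (fun th => Cmod (dgam gam th)) a b
                                /\ RInt (fun th => Cmod (dgam gam th)) a b <= B * (b - a)).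
    { intros a b Hab. split.
      - replace (m * (b - a)) with (RInt (fun _ => m) a b)
          by (rewrite RInt_const; apply Rmult_comm).
        apply RInt_le; auto. apply ex_RInt_const.
      - replace (B * (b - a)) with (RInt (fun _ => B) a b)
          by (rewrite RInt_const; apply Rmult_comm).
        apply RInt_le; auto. apply ex_RInt_const. }
    destruct (Rle_dec x y) as [Hxy|Hxy].
    + destruct (Hlt x y Hxy) as [H1 H2].
      rewrite (Rabs_left1 (x - y)) by lra. rewrite Rabs_pos_eq by nra. lra.
    + destruct (Hlt y x ltac:(lra)) as [H1 H2].
      rewrite <- (opp_RInt_swap (V := R_CompleteNormedModule)) by apply Hex.
      change (opp ?a) with (- a). rewrite Rabs_Ropp.
      rewrite (Rabs_pos_eq (x - y)) by lra. rewrite Rabs_pos_eq by nra. lra.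
  - destruct (arc_length_le 1 ltac:(generalize (disc_nonempty _ _ Hdisc); lia) Hnd) as [_ HLt].
    destruct (chord_arc Hgam _ HLt) as [c [Hc Hchord]].
    exists c, B. split; [exact Hc|]. split; [exact HB|].
    intros j x y Hj Hx Hy. split; [|apply HL]. apply Hchord.
    eapply Rle_trans; [|apply (arc_length_le j Hj Hnd)].
    apply Rabs_le. lra.
Qed.

Lemma shift_left_limit (v : C -> C) (x : R) (l : C) :
  filterlim (fun y => v (gam y)) (at_left x) (locally (T := C_UniformSpace) l) <->
  filterlim (fun y => v (gam y)) (at_left (x + 2 * PI)) (locally (T := C_UniformSpace) l).
Proof.
  rewrite !left_limit_iff. split; intros H eps Heps; destruct (H eps Heps) as [d [Hd Hy]];
    exists d; split; auto; intros y Hyd.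
  - replace y with ((y - 2 * PI) + 2 * PI) by ring. rewrite (contour_periodic _ Hgam).
    apply Hy. lra.
  - rewrite <- (contour_periodic _ Hgam). apply Hy. lra.
Qed.

(** The right ends of the arcs are the points [thd j] shifted cyclically by one index, the first of
    them moved by a period. *)
Lemma left_limits_at_arc_ends (v : C -> C) :
  (forall j, (1 <= j <= nd)%nat -> filterlim (fun x => v (gam x)) (at_left (thd j))
     (locally (T := C_UniformSpace) (v (gam (thd j))))) <->
  (forall j, (1 <= j <= nd)%nat -> filterlim (fun x => v (gam x)) (at_left (arc_r nd thd j))
     (locally (T := C_UniformSpace) (v (gam (arc_r nd thd j))))).
Proof.
  assert (Hnd := disc_nonempty _ _ Hdisc). split; intros H j Hj.
  - destruct (Nat.eq_dec j nd) as [->|Hne].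
    + rewrite arc_r_last, (contour_periodic _ Hgam).
      apply (proj1 (shift_left_limit v _ _)). apply H. lia.
    + rewrite arc_r_lt by lia. apply H. lia.
  - destruct (Nat.eq_dec j 1) as [->|Hne].
    + apply (proj2 (shift_left_limit v _ _)). rewrite <- (contour_periodic _ Hgam), <- arc_r_last.
      apply H. lia.
    + specialize (H (pred j) ltac:(lia)). rewrite arc_r_lt in H by lia.
      replace (S (pred j)) with j in H by lia. exact H.
Qed.

Lemma lat_left_eq (v : C -> C) x (l : C) :
  filterlim (fun y => v (gam y)) (at_left x) (locally (T := C_UniformSpace) l) ->
  lat_left gam v x = l.
Proof.
  intros H. unfold lat_left.
  exact (iota_filterlim_locally (V := C_R_CompleteNormedModule) (F := at_left x) _ _ H).
Qed.

Lemma lat_right_eq (v : C -> C) x (l : C) :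
  filterlim (fun y => v (gam y)) (at_right x) (locally (T := C_UniformSpace) l) ->
  lat_right gam v x = l.
Proof.
  intros H. unfold lat_right.
  exact (iota_filterlim_locally (V := C_R_CompleteNormedModule) (F := at_right x) _ _ H).
Qed.

Section PiecewiseHolder.

Context {s : R} (Hs : 0 < s) {v : C -> C} (Hv : in_X gam nd thd s v).

(** The right end is included because functions carry their incoming values; at the left end the
    outgoing limit differs in general. *)
Lemma arc_val_interior j x : (1 <= j <= nd)%nat ->
  arc_l thd j < x <= arc_r nd thd j -> arc_val gam nd thd v j x = v (gam x).
Proof.
  intros Hj Hx. unfold arc_val.
  destruct (Req_EM_T x (arc_l thd j)); [lra|].
  destruct (Req_EM_T x (arc_r nd thd j)) as [->|]; [|reflexivity].
  apply lat_left_eq.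
  exact (proj1 (left_limits_at_arc_ends v) (X_left _ _ _ _ _ Hv) j Hj).
Qed.

Lemma arc_val_start j : arc_val gam nd thd v j (arc_l thd j) = lat_right gam v (thd j).
Proof. unfold arc_val. now destruct (Req_EM_T (arc_l thd j) (arc_l thd j)). Qed.

Lemma jump_eq j : (1 <= j <= nd)%nat ->
  jump gam v (thd j) = (arc_val gam nd thd v j (arc_l thd j) - v (gam (thd j)))%C.
Proof.
  intros Hj. unfold jump. rewrite arc_val_start.
  now rewrite (lat_left_eq v _ _ (X_left _ _ _ _ _ Hv j Hj)).
Qed.

Lemma arc_val_holder j : (1 <= j <= nd)%nat -> exists M, 0 <= M /\
  holder_on s M (arc_l thd j) (arc_r nd thd j) (arc_val gam nd thd v j).
Proof.
  intros Hj. destruct arc_dist_equiv as [c [B [Hc [HB Hd]]]].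
  destruct (X_holder _ _ _ _ _ Hv j Hj) as [M HM].
  assert (HM0 := Rabs_pos M). assert (HBs := Rpower_pos B s).
  exists (Rabs M * Rpower B s). split; [nra|].
  apply holder_completion with (f := fun x => v (gam x)); try assumption.
  - nra.
  - now apply arc_length_pos.
  - intros x y Hx Hy Hxy. eapply Rle_trans; [now apply HM|].
    assert (Hr : 0 < Rabs (x - y)) by (apply Rabs_pos_lt; lra).
    assert (Hdd := Hd j x y Hj ltac:(lra) ltac:(lra)).
    assert (Hle : Rpower (arc_dist gam nd x y) s <= Rpower B s * Rpower (Rabs (x - y)) s).
    { rewrite Rpower_mult_distr by lra. apply Rle_Rpower_l; [lra|]. nra. }
    assert (Hp := Rpower_pos (arc_dist gam nd x y) s).
    generalize (Rle_abs M). rewrite Rmult_assoc. nra.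
  - intros x Hx. apply arc_val_interior; lra || assumption.
  - rewrite arc_val_start. destruct (X_right _ _ _ _ _ Hv j Hj) as [l Hl].
    rewrite (lat_right_eq v _ l Hl). exact Hl.
  - rewrite arc_val_interior; [|assumption|].
    + exact (proj1 (left_limits_at_arc_ends v) (X_left _ _ _ _ _ Hv) j Hj).
    + generalize (arc_length_pos j Hj). lra.
Qed.

(** [rsup] returns 0 on a set unbounded above, so [arc_val_holder] first bounds both sets; only then
    do the suprema dominate their elements. *)
Lemma norm_X_arc j : (1 <= j <= nd)%nat ->
  0 <= arc_sup gam nd thd v j /\ 0 <= arc_semi gam nd thd s v j /\
  (forall x, arc_l thd j <= x <= arc_r nd thd j ->
     Cmod (arc_val gam nd thd v j x) <= arc_sup gam nd thd v j) /\
  (forall x y, arc_l thd j <= x <= arc_r nd thd j -> arc_l thd j <= y <= arc_r nd thd j ->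
     x <> y -> Cmod (arc_val gam nd thd v j x - arc_val gam nd thd v j y)
               <= arc_semi gam nd thd s v j * Rpower (arc_dist gam nd x y) s).
Proof.
  intros Hj. assert (HPI := PI_RGT_0).
  destruct (arc_val_holder j Hj) as [M [HM H]].
  destruct arc_dist_equiv as [c [B [Hc [HB Hd]]]].
  assert (Hlen := arc_length_pos j Hj). assert (Hper := arc_in_period j Hj).
  set (a := arc_l thd j) in *. set (b := arc_r nd thd j) in *.
  set (w := arc_val gam nd thd v j) in *.
  assert (H1 : forall x, a <= x <= b -> Cmod (w x) <= arc_sup gam nd thd v j).
  { intros x Hx. apply (le_rsup _ (Cmod (w a) + M * Rpower (2 * PI) s)).
    - intros r [y [Hy ->]]. fold a b in Hy. destruct (Req_dec y a) as [->|Hne].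
      + generalize (Rpower_pos (2 * PI) s). fold w. nra.
      + generalize (Cmod_minus_triangle (w y) (w a) 0), (H y a Hy ltac:(lra) Hne).
        replace (w y - 0)%C with (w y) by ring. replace (w a - 0)%C with (w a) by ring.
        assert (Rpower (Rabs (y - a)) s <= Rpower (2 * PI) s).
        { rewrite Rabs_pos_eq by lra. apply Rle_Rpower_l; lra. }
        fold w. nra.
    - exists x. auto. }
  assert (H2 : forall x y, a <= x <= b -> a <= y <= b -> x <> y ->
     Cmod (w x - w y) / Rpower (arc_dist gam nd x y) s <= arc_semi gam nd thd s v j).
  { intros x y Hx Hy Hxy. apply (le_rsup _ (M * Rpower (/ c) s)).
    - intros r [x' [y' [Hx' [Hy' [Hxy' ->]]]]].
      apply Rle_div_l; [apply Rpower_pos|].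
      eapply Rle_trans; [now apply H|]. rewrite Rmult_assoc.
      apply Rmult_le_compat_l; [exact HM|].
      assert (Hr : 0 < Rabs (x' - y')) by (apply Rabs_pos_lt; lra).
      destruct (Hd j x' y' Hj Hx' Hy') as [Hd1 _].
      assert (Hdp : 0 < arc_dist gam nd x' y') by nra.
      rewrite Rpower_mult_distr by (auto using Rinv_0_lt_compat).
      apply Rle_Rpower_l; [lra|]. split; [exact Hr|].
      apply Rmult_le_reg_l with c; [exact Hc|].
      rewrite <- Rmult_assoc, Rinv_r, Rmult_1_l by lra. exact Hd1.
    - exists x, y. auto. }
  split; [|split; [|split]].
  - eapply Rle_trans; [apply Cmod_ge_0|apply (H1 a); lra].
  - eapply Rle_trans; [|apply (H2 a b); lra].
    apply Rmult_le_pos; [apply Cmod_ge_0|]. left. apply Rinv_0_lt_compat, Rpower_pos.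
  - exact H1.
  - intros x y Hx Hy Hxy. apply Rle_div_l; [apply Rpower_pos|]. now apply H2.
Qed.

Lemma norm_X_bounds j : (1 <= j <= nd)%nat ->
  (forall x, arc_l thd j <= x <= arc_r nd thd j ->
     Cmod (arc_val gam nd thd v j x) <= norm_X gam nd thd s v) /\
  (forall x y, arc_l thd j <= x <= arc_r nd thd j -> arc_l thd j <= y <= arc_r nd thd j ->
     x <> y -> Cmod (arc_val gam nd thd v j x - arc_val gam nd thd v j y)
               <= norm_X gam nd thd s v * Rpower (arc_dist gam nd x y) s).
Proof.
  intros Hj. destruct (norm_X_arc j Hj) as [H1 [H2 [H3 H4]]].
  assert (HN : arc_sup gam nd thd v j + arc_semi gam nd thd s v j <= norm_X gam nd thd s v).
  { apply fold_right_Rmax_ge.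
    apply (in_map (fun j => arc_sup gam nd thd v j + arc_semi gam nd thd s v j)).
    apply in_seq. lia. }
  split.
  - intros x Hx. specialize (H3 x Hx). lra.
  - intros x y Hx Hy Hxy. specialize (H4 x y Hx Hy Hxy).
    generalize (Rpower_pos (arc_dist gam nd x y) s). nra.
Qed.

(** The arc starts at the last [thd j] below [x]; induction on the number of arcs finds it. *)
Lemma arc_of_parameter x : thd 1%nat < x <= thd 1%nat + 2 * PI ->
  exists j, (1 <= j <= nd)%nat /\ arc_l thd j < x <= arc_r nd thd j.
Proof.
  intros Hx. assert (Hnd := disc_nonempty _ _ Hdisc).
  assert (H : forall m, (1 <= m <= nd)%nat -> x <= arc_r nd thd m ->
            exists j, (1 <= j <= m)%nat /\ arc_l thd j < x <= arc_r nd thd j).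
  { induction m as [|m IH]; intros Hm Hxm; [lia|].
    destruct (Rlt_dec (thd (S m)) x) as [Hlt|Hle].
    - exists (S m). split; [lia|]. split; [exact Hlt|exact Hxm].
    - destruct (Nat.eq_dec m 0) as [->|Hm0]; [lra|].
      destruct IH as [j [Hj1 Hj2]]; [lia| |].
      + rewrite arc_r_lt by lia. lra.
      + exists j. split; [lia|exact Hj2]. }
  apply (H nd); [lia|]. rewrite arc_r_last. lra.
Qed.

Lemma norm_X_sup t : on_curve gam t -> Cmod (v t) <= norm_X gam nd thd s v.
Proof.
  intros [th <-].
  destruct (shift_into_period (thd 1%nat) (th)) as [n Hn].
  (* Arcs contain their right end and the period its left one, so the point at [thd 1] is moved to
     the end of the last arc. *)
  destruct (Req_dec (th + IZR n * (2 * PI)) (thd 1%nat)) as [E|E].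
  - destruct (arc_of_parameter (th + IZR n * (2 * PI) + 2 * PI)) as [j [Hj Hx]]; [lra|].
    rewrite <- (gam_shift Hgam n), <- (contour_periodic _ Hgam).
    rewrite <- (arc_val_interior j) by assumption.
    apply (norm_X_bounds j Hj). lra.
  - destruct (arc_of_parameter (th + IZR n * (2 * PI))) as [j [Hj Hx]]; [lra|].
    rewrite <- (gam_shift Hgam n), <- (arc_val_interior j) by assumption.
    apply (norm_X_bounds j Hj). lra.
Qed.

End PiecewiseHolder.

End Discontinuities.

(** * The jump part *)

Lemma sum_n_m_lsum (F : nat -> C) (n : nat) :
  sum_n_m (G := C_AbelianMonoid) F 1 n = lsum (seq 1 n) F.
Proof.
  induction n as [|n IH].
  - apply (sum_n_m_zero (G := C_AbelianMonoid)). lia.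
  - rewrite (sum_n_Sm (G := C_AbelianMonoid)) by lia. rewrite IH, seq_S, lsum_app.
    change (lsum (seq 1 n) F + F (S n) = lsum (seq 1 n) F + (F (S n) + 0))%C. ring.
Qed.

(** The coefficients are arbitrary: with all of them 0, [in_X_sum] also covers functions without
    jumps. *)
Definition jump_part (gam : R -> C) (nd : nat) (thd : nat -> R) (a : nat -> C) (t : C) : C :=
  lsum (seq 1 nd) (fun i => a i * RtoC (Ggen gam thd i t))%C.

(* The affine function of the parameter that [jump_part] agrees with on the
   j-th arc: there H_i = 1 exactly for i <= j, also beyond the cut, where
   H_i drops to 0 and R by 1. *)
Definition arc_jump_part (nd : nat) (a : nat -> C) (j : nat) (x : R) : C :=
  lsum (seq 1 nd) (fun i =>
    a i * RtoC ((if Nat.leb i j then 1 else 0) - x / (2 * PI)))%C.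

Lemma Jpart_eq gam nd thd f t :
  Jpart gam nd thd f t = jump_part gam nd thd (fun j => jump gam f (thd j)) t.
Proof. apply sum_n_m_lsum. Qed.

Lemma param_gam gam x : is_contour gam -> 0 <= x < 2 * PI -> param gam (gam x) = x.
Proof.
  intros Hgam Hx.
  assert (H : 0 <= param gam (gam x) < 2 * PI /\ gam (param gam (gam x)) = gam x).
  { unfold param. apply epsilon_spec. exists x. auto. }
  apply (contour_simple _ Hgam); tauto.
Qed.

Section JumpPart.

Context {gam : R -> C} (Hgam : is_contour gam).
Context {nd : nat} {thd : nat -> R} (Hdisc : is_disc nd thd).

Lemma Ggen_gam i x : 0 <= x < 2 * PI ->
  Ggen gam thd i (gam x) = (if Rle_dec x (thd i) then 0 else 1) - x / (2 * PI).
Proof. intros Hx. unfold Ggen, Hgen, Rgen. now rewrite param_gam. Qed.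

Lemma Ggen_bound i t : on_curve gam t -> Rabs (Ggen gam thd i t) <= 1.
Proof.
  assert (HPI := PI_RGT_0). intros [th <-].
  destruct (shift_into_period 0 th) as [n Hn]. rewrite <- (gam_shift Hgam n).
  rewrite Ggen_gam by lra. set (x := th + IZR n * (2 * PI)) in *.
  assert (0 <= x / (2 * PI)) by (apply Rle_div_r; lra).
  assert (x / (2 * PI) < 1) by (apply Rlt_div_l; lra).
  apply Rabs_le. destruct (Rle_dec _ _); lra.
Qed.

Lemma Ggen_arc i j x : (1 <= i <= nd)%nat -> (1 <= j <= nd)%nat ->
  arc_l thd j < x <= arc_r nd thd j ->
  Ggen gam thd i (gam x) = (if Nat.leb i j then 1 else 0) - x / (2 * PI).
Proof.
  assert (HPI := PI_RGT_0). intros Hi Hj Hx. unfold arc_l in Hx.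
  assert (Hjr := thd_range Hdisc j Hj).
  destruct (Rlt_dec x (2 * PI)) as [Hlt|Hge].
  - rewrite Ggen_gam by lra. f_equal.
    destruct (Nat.leb_spec i j) as [Hij|Hij]; destruct (Rle_dec x (thd i)) as [Hle|Hle];
      try reflexivity; exfalso.
    + generalize (thd_le Hdisc i j ltac:(lia) ltac:(lia) ltac:(lia)). lra.
    + rewrite arc_r_lt in Hx by lia.
      generalize (thd_le Hdisc (S j) i ltac:(lia) ltac:(lia) ltac:(lia)). lra.
  - destruct (Nat.eq_dec j nd) as [->|Hne].
    + rewrite arc_r_last in Hx.
      replace (gam x) with (gam (x - 2 * PI))
        by (rewrite <- (contour_periodic _ Hgam); f_equal; ring).
      generalize (thd_le Hdisc 1 i ltac:(lia) ltac:(lia) ltac:(lia)), (thd_range Hdisc 1 ltac:(lia)).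
      intros. rewrite Ggen_gam by lra.
      destruct (Nat.leb_spec i nd); [|lia].
      destruct (Rle_dec (x - 2 * PI) (thd i)); [|lra]. field. lra.
    + exfalso. rewrite arc_r_lt in Hx by lia.
      generalize (thd_range Hdisc (S j) ltac:(lia)). lra.
Qed.

Lemma jump_part_arc a j x : (1 <= j <= nd)%nat -> arc_l thd j < x <= arc_r nd thd j ->
  jump_part gam nd thd a (gam x) = arc_jump_part nd a j x.
Proof.
  intros Hj Hx. apply lsum_ext. intros i Hi%in_seq. rewrite (Ggen_arc i j); auto. lia.
Qed.

(** At [thd j] itself H_j still has its incoming value 0, while every other H_i already agrees with
    the arc that starts there. *)
Lemma jump_part_start a j : (1 <= j <= nd)%nat ->
  jump_part gam nd thd a (gam (thd j)) = (arc_jump_part nd a j (thd j) - a j)%C.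
Proof.
  intros Hj. assert (Hjr := thd_range Hdisc j Hj).
  rewrite <- (lsum_indicator (seq 1 nd) j a (seq_NoDup _ _)) by (apply in_seq; lia).
  apply Ceq_minus. unfold jump_part, arc_jump_part.
  rewrite <- !lsum_minus.
  rewrite (lsum_ext _ _ (fun _ => RtoC 0)); [apply lsum_zero|].
  intros i Hi%in_seq. rewrite Ggen_gam by lra.
  destruct (Nat.eqb_spec i j) as [->|Hne].
  - rewrite Nat.leb_refl. destruct (Rle_dec (thd j) (thd j)); [|lra].
    rewrite !RtoC_minus. ring.
  - destruct (Nat.leb_spec i j) as [Hij|Hij]; destruct (Rle_dec (thd j) (thd i)) as [Hle|Hle].
    + generalize (thd_lt Hdisc i j ltac:(lia) ltac:(lia) ltac:(lia)). lra.
    + ring.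
    + ring.
    + generalize (thd_lt Hdisc j i ltac:(lia) ltac:(lia) ltac:(lia)). lra.
Qed.

Lemma fold_right_const (l : list nat) : fold_right (fun (_ : nat) s => 1 + s) 0 l = INR (length l).
Proof. induction l as [|a l IH]; [reflexivity|]. simpl length. rewrite S_INR, <- IH. simpl. ring. Qed.

Lemma jump_part_bound a A t : on_curve gam t ->
  (forall j, (1 <= j <= nd)%nat -> Cmod (a j) <= A) ->
  Cmod (jump_part gam nd thd a t) <= A * INR nd.
Proof.
  intros Ht Ha. rewrite <- (length_seq nd 1) at 2. rewrite <- fold_right_const.
  apply Cmod_lsum_le. intros i Hi%in_seq. rewrite Cmod_mult, Cmod_R.
  apply Rmult_le_compat; [apply Cmod_ge_0|apply Rabs_pos| |now apply Ggen_bound].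
  apply Ha. lia.
Qed.

(** The step terms cancel; in each summand only the linear term varies, with a slope of modulus 1 /
    (2 PI), at most 1. *)
Lemma arc_jump_part_lipschitz a A j x y :
  (forall j, (1 <= j <= nd)%nat -> Cmod (a j) <= A) ->
  Cmod (arc_jump_part nd a j x - arc_jump_part nd a j y) <= A * INR nd * Rabs (x - y).
Proof.
  intros Ha. assert (HPI := PI_RGT_0). assert (H2 := PI2_1).
  unfold arc_jump_part.
  rewrite <- lsum_minus.
  replace (A * INR nd * Rabs (x - y)) with (A * Rabs (x - y) * INR nd) by ring.
  rewrite <- (length_seq nd 1) at 2. rewrite <- fold_right_const.
  apply Cmod_lsum_le. intros i Hi%in_seq.
  replace (a i * RtoC _ - _)%C with (a i * RtoC ((y - x) / (2 * PI)))%C.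
  2:{ rewrite !RtoC_minus. unfold Rdiv at 1. rewrite Rmult_minus_distr_r, RtoC_minus.
      unfold Rdiv. ring. }
  rewrite Cmod_mult, Cmod_R, Rmult_1_r.
  apply Rmult_le_compat; [apply Cmod_ge_0|apply Rabs_pos|apply Ha; lia|].
  unfold Rdiv. rewrite Rabs_mult, Rabs_minus_sym, Rabs_inv, (Rabs_pos_eq (2 * PI)) by lra.
  rewrite <- (Rmult_1_r (Rabs (x - y))) at 2.
  apply Rmult_le_compat_l; [apply Rabs_pos|].
  rewrite <- Rinv_1. apply Rinv_le_contravar; lra.
Qed.

Lemma integrable_Ggen i : (1 <= i <= nd)%nat -> integrable gam (fun t => RtoC (Ggen gam thd i t)).
Proof.
  intros Hi h Hh. assert (HPI := PI_RGT_0). assert (Hr := thd_range Hdisc i Hi).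
  assert (Hc : forall e b c, ex_CInt (fun x => h x * RtoC (e - x / (2 * PI)))%C b c).
  { intros e b c. apply ex_CInt_continuous. intros x.
    apply continuous_C_mult; [apply Hh|]. apply continuous_RtoC.
    apply (ex_derive_continuous (fun x => e - x / (2 * PI))). auto_derive. lra. }
  (* Inside each of the two pieces the generator is affine in the parameter. *)
  apply (ex_RInt_Chasles (V := C_R_CompleteNormedModule) _ 0 (thd i)).
  - apply (ex_RInt_ext (V := C_R_CompleteNormedModule)
             (fun x => h x * RtoC (0 - x / (2 * PI)))%C); [|apply Hc].
    intros x. rewrite Rmin_left, Rmax_right by lra. intros Hx.
    rewrite Ggen_gam by lra. destruct (Rle_dec x (thd i)); [reflexivity|lra].
  - apply (ex_RInt_ext (V := C_R_CompleteNormedModule)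
             (fun x => h x * RtoC (1 - x / (2 * PI)))%C); [|apply Hc].
    intros x. rewrite Rmin_left, Rmax_right by lra. intros Hx.
    rewrite Ggen_gam by lra. destruct (Rle_dec x (thd i)); [lra|reflexivity].
Qed.

Lemma integrable_jump_part a : integrable gam (jump_part gam nd thd a).
Proof.
  assert (H : forall l, (forall i, In i l -> (1 <= i <= nd)%nat) ->
     integrable gam (fun t => lsum l (fun i => a i * RtoC (Ggen gam thd i t))%C)).
  { induction l as [|i l IH]; intros Hl; simpl.
    - apply integrable_pullback_continuous. intros th. apply continuous_C_const.
    - apply (integrable_lin gam (a i) (fun t => RtoC (Ggen gam thd i t))).
      + apply integrable_Ggen. auto with datatypes.
      + auto with datatypes. }
  apply H. intros i Hi%in_seq. lia.
Qed.

Lemma arc_dist_power s : 0 < s -> exists K, 0 < K /\ forall j x y, (1 <= j <= nd)%nat ->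
  arc_l thd j <= x <= arc_r nd thd j -> arc_l thd j <= y <= arc_r nd thd j -> x <> y ->
  Rpower (arc_dist gam nd x y) s <= K * Rpower (Rabs (x - y)) s /\
  Rpower (Rabs (x - y)) s <= K * Rpower (arc_dist gam nd x y) s.
Proof.
  intros Hs. destruct (arc_dist_equiv Hgam Hdisc) as [c [B [Hc [HB Hd]]]].
  assert (Hci := Rinv_0_lt_compat c Hc).
  assert (HK1 := Rpower_pos B s). assert (HK2 := Rpower_pos (/ c) s).
  exists (Rpower B s + Rpower (/ c) s). split; [lra|].
  intros j x y Hj Hx Hy Hxy.
  assert (Hr : 0 < Rabs (x - y)) by (apply Rabs_pos_lt; lra).
  destruct (Hd j x y Hj Hx Hy) as [Hd1 Hd2].
  assert (Hdp : 0 < arc_dist gam nd x y) by nra.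
  assert (Hp1 := Rpower_pos (Rabs (x - y)) s). assert (Hp2 := Rpower_pos (arc_dist gam nd x y) s).
  split.
  - apply Rle_trans with (Rpower B s * Rpower (Rabs (x - y)) s); [|nra].
    rewrite Rpower_mult_distr by lra. apply Rle_Rpower_l; lra.
  - apply Rle_trans with (Rpower (/ c) s * Rpower (arc_dist gam nd x y) s); [|nra].
    rewrite Rpower_mult_distr by lra. apply Rle_Rpower_l; [lra|]. split; [exact Hr|].
    apply Rmult_le_reg_l with c; [exact Hc|].
    rewrite <- Rmult_assoc, Rinv_r, Rmult_1_l by lra. exact Hd1.
Qed.

Lemma jump_bound s f : 0 < s -> in_X gam nd thd s f -> forall j, (1 <= j <= nd)%nat ->
  Cmod (jump gam f (thd j)) <= 2 * norm_X gam nd thd s f.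
Proof.
  intros Hs Hf j Hj. rewrite (jump_eq Hf j Hj).
  eapply Rle_trans; [apply Cmod_minus_le|].
  generalize (norm_X_sup Hgam Hdisc Hs Hf _ (on_curve_gam gam (thd j))),
    (proj1 (norm_X_bounds Hgam Hdisc Hs Hf j Hj) (arc_l thd j)), (arc_length_pos Hdisc j Hj).
  intros H1 H2 H3. specialize (H2 ltac:(lra)). lra.
Qed.

Lemma norm_X_nonneg s f : 0 < s -> in_X gam nd thd s f -> 0 <= norm_X gam nd thd s f.
Proof.
  intros Hs Hf. eapply Rle_trans; [apply Cmod_ge_0|].
  apply (norm_X_sup Hgam Hdisc Hs Hf _ (on_curve_gam gam 0)).
Qed.

(* A pair of parameters more than half a period apart is replaced by a closer
   pair for the same two points. *)
Lemma holder_parameter_chord s : 0 < s -> exists K, 0 < K /\ forall M b (F : C -> C), 0 <= M ->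
  holder_on s M b (b + 2 * PI) (fun x => F (gam x)) ->
  forall t r, on_curve gam t -> on_curve gam r -> t <> r ->
    Cmod (F t - F r) <= K * M * Rpower (Cmod (t - r)) s.
Proof.
  intros Hs. assert (HPI := PI_RGT_0).
  destruct (chord_arc Hgam PI ltac:(lra)) as [c [Hc Hchord]].
  assert (Hci := Rinv_0_lt_compat c Hc).
  exists (2 * Rpower (/ c) s). split; [generalize (Rpower_pos (/ c) s); lra|].
  intros M b F HM HF.
  (* Two periods leave room for the shifted parameter; the second copy costs another [M]. *)
  assert (HF2 : holder_on s (M + M) b (b + 4 * PI) (fun x => F (gam x))).
  { apply holder_on_glue with (b + 2 * PI); try assumption; [lra|].
    intros x y Hx Hy Hxy.
    replace x with ((x - 2 * PI) + 2 * PI) at 1 by ring.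
    replace y with ((y - 2 * PI) + 2 * PI) at 1 by ring.
    rewrite !(contour_periodic _ Hgam).
    replace (x - y) with ((x - 2 * PI) - (y - 2 * PI)) by ring.
    apply HF; lra. }
  assert (Hnear : forall x y, b <= x <= b + 4 * PI -> b <= y <= b + 4 * PI ->
     Rabs (x - y) <= PI -> gam x <> gam y ->
     Cmod (F (gam x) - F (gam y)) <= 2 * Rpower (/ c) s * M * Rpower (Cmod (gam x - gam y)) s).
  { intros x y Hx Hy Hxy Hne.
    assert (x <> y) by congruence.
    assert (Hr : 0 < Rabs (x - y)) by (apply Rabs_pos_lt; lra).
    specialize (Hchord x y Hxy).
    assert (Hg : 0 < Cmod (gam x - gam y)) by nra.
    eapply Rle_trans; [now apply (HF2 x y)|].
    replace (2 * Rpower (/ c) s * M * Rpower (Cmod (gam x - gam y)) s)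
      with ((M + M) * (Rpower (/ c) s * Rpower (Cmod (gam x - gam y)) s)) by ring.
    apply Rmult_le_compat_l; [lra|].
    rewrite Rpower_mult_distr by lra. apply Rle_Rpower_l; [lra|]. split; [exact Hr|].
    apply Rmult_le_reg_l with c; [exact Hc|].
    rewrite <- Rmult_assoc, Rinv_r, Rmult_1_l by lra. exact Hchord. }
  intros t r [x <-] [y <-] Hne.
  destruct (shift_into_period b x) as [n Hn]. destruct (shift_into_period b y) as [m Hm].
  rewrite <- (gam_shift Hgam n x), <- (gam_shift Hgam m y) in *.
  set (x' := x + IZR n * (2 * PI)) in *. set (y' := y + IZR m * (2 * PI)) in *.
  destruct (Rle_dec (Rabs (x' - y')) PI) as [H|H].
  - apply Hnear; try assumption; lra.
  (* The smaller parameter moves up by one period, which brings the gap below half a period. *)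
  - unfold Rabs in H. destruct (Rcase_abs (x' - y')).
    + rewrite <- (contour_periodic _ Hgam x') in *.
      apply Hnear; try assumption; try lra. apply Rabs_le. lra.
    + rewrite <- (contour_periodic _ Hgam y') in *.
      apply Hnear; try assumption; try lra. apply Rabs_le. lra.
Qed.

(** Consecutive arcs share an end, where one function [F] serves both sides; each gluing adds one
    [M]. *)
Lemma holder_all_arcs s M (F : R -> C) : 0 < s -> 0 <= M ->
  (forall j, (1 <= j <= nd)%nat -> holder_on s M (arc_l thd j) (arc_r nd thd j) F) ->
  holder_on s (INR nd * M) (thd 1%nat) (thd 1%nat + 2 * PI) F.
Proof.
  intros Hs HM HF. assert (Hnd := disc_nonempty _ _ Hdisc).
  rewrite <- (arc_r_last (nd := nd)).
  assert (H : forall j, (1 <= j <= nd)%nat -> holder_on s (INR j * M) (thd 1%nat) (arc_r nd thd j) F).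
  { induction j as [|j IH]; intros Hj; [lia|].
    destruct (Nat.eq_dec j 0) as [->|Hj0].
    - simpl INR. rewrite Rmult_1_l. apply (HF 1%nat). lia.
    - rewrite S_INR, Rmult_plus_distr_r, Rmult_1_l.
      apply holder_on_glue with (thd (S j)); try assumption.
      + apply Rmult_le_pos; [apply pos_INR|exact HM].
      + split; [apply (thd_le Hdisc); lia|].
        left. apply (arc_length_pos Hdisc (S j)). lia.
      + rewrite <- (arc_r_lt (nd := nd) j) by lia. apply IH. lia.
      + apply (HF (S j)). lia. }
  apply H. lia.
Qed.

Lemma le_two_PI_Rpower s r : 0 < s <= 1 -> 0 < r <= 2 * PI ->
  r <= 2 * PI * Rpower r s.
Proof.
  intros Hs Hr. assert (H2 := PI2_1). rewrite <- (Rpower_1 r) at 1 by lra.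
  apply Rpower_le_lower_exponent; lra.
Qed.

Lemma fC_bounds s : 0 < s <= 1 -> exists K, 0 < K /\ forall f, in_X gam nd thd s f ->
  let N := norm_X gam nd thd s f in
  (forall t, on_curve gam t -> Cmod (Jpart gam nd thd f t) <= K * N) /\
  (forall t, on_curve gam t -> Cmod (fC gam nd thd f t) <= K * N) /\
  (forall t r, on_curve gam t -> on_curve gam r -> t <> r ->
     Cmod (fC gam nd thd f t - fC gam nd thd f r) <= K * N * Rpower (Cmod (t - r)) s).
Proof.
  intros Hs. assert (HPI := PI_RGT_0).
  destruct (arc_dist_power s ltac:(lra)) as [K1 [HK1 Hdp]].
  destruct (holder_parameter_chord s ltac:(lra)) as [K2 [HK2 Hchord]].
  assert (Hn := pos_INR nd). set (n := INR nd) in *.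
  (* [K1] converts the arc distance in the seminorm of f; the rest comes from the Lipschitz bound of
     the affine part, whose jumps are at most [2 * N]. *)
  set (K3 := K1 + 2 * n * (2 * PI)).
  assert (HK3 : 0 < K3) by (unfold K3; nra).
  (* One constant for all three bounds: [2 * n] for J_f, 1 more for f, and the last term for gluing
     and passing to chords. *)
  exists (1 + 2 * n + K2 * (n * K3)). split.
  { assert (0 <= n * K3) by nra. nra. }
  intros f Hf N.
  assert (HN : 0 <= N) by (apply norm_X_nonneg; [lra|exact Hf]).
  set (a := fun j => jump gam f (thd j)).
  assert (Ha : forall j, (1 <= j <= nd)%nat -> Cmod (a j) <= 2 * N)
    by (intros; apply jump_bound; [lra|assumption..]).
  assert (HJ : forall t, on_curve gam t -> Cmod (Jpart gam nd thd f t) <= 2 * N * n).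
  { intros t Ht. rewrite Jpart_eq. now apply jump_part_bound. }
  assert (Hp3 : 0 <= K2 * (n * K3)) by (apply Rmult_le_pos; nra).
  split; [|split].
  - intros t Ht. eapply Rle_trans; [now apply HJ|]. nra.
  - intros t Ht. eapply Rle_trans; [apply Cmod_minus_le|].
    generalize (HJ t Ht), (norm_X_sup Hgam Hdisc (proj1 Hs) Hf t Ht). fold N. nra.
  - assert (Harc : forall j, (1 <= j <= nd)%nat ->
       holder_on s (K3 * N) (arc_l thd j) (arc_r nd thd j) (fun x => fC gam nd thd f (gam x))).
    { intros j Hj.
      (* At the left end the jumps of f and of J_f cancel, so f_C takes its outgoing limit there:
         this is its continuity across [thd j]. *)
      assert (E : forall x, arc_l thd j <= x <= arc_r nd thd j ->
         fC gam nd thd f (gam x) = (arc_val gam nd thd f j x - arc_jump_part nd a j x)%C).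
      { intros x Hx. unfold fC. rewrite Jpart_eq. fold a.
        destruct (Req_dec x (arc_l thd j)) as [->|Hne].
        - unfold arc_l at 1 2. rewrite jump_part_start by assumption.
          unfold a at 2. rewrite (jump_eq Hf j Hj). unfold arc_l. ring.
        - rewrite (jump_part_arc a j) by (auto; lra).
          rewrite (arc_val_interior Hgam Hdisc Hf j) by (auto; lra). reflexivity. }
      intros x y Hx Hy Hxy. rewrite (E x Hx), (E y Hy).
      rewrite Cminus_minus_minus.
      eapply Rle_trans; [apply Cmod_minus_le|].
      assert (H1 := proj2 (norm_X_bounds Hgam Hdisc (proj1 Hs) Hf j Hj) x y Hx Hy Hxy).
      assert (H2 := arc_jump_part_lipschitz a (2 * N) j x y Ha).
      assert (Hr : 0 < Rabs (x - y)) by (apply Rabs_pos_lt; lra).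
      assert (Hr2 : Rabs (x - y) <= 2 * PI).
      { generalize (arc_in_period Hdisc j Hj). intros. apply Rabs_le. lra. }
      assert (H3 := le_two_PI_Rpower s _ Hs (conj Hr Hr2)).
      destruct (Hdp j x y Hj Hx Hy Hxy) as [H4 _].
      fold N in H1. fold n in H2. set (P := Rpower (Rabs (x - y)) s) in *.
      assert (N * Rpower (arc_dist gam nd x y) s <= N * (K1 * P)) by now apply Rmult_le_compat_l.
      assert (2 * N * n * Rabs (x - y) <= 2 * N * n * (2 * PI * P))
        by (apply Rmult_le_compat_l; [nra|exact H3]).
      unfold K3. lra. }
    intros t r Ht Hr Htr.
    assert (HM : 0 <= INR nd * (K3 * N)) by (apply Rmult_le_pos; [exact Hn|nra]).
    eapply Rle_trans.
    + apply (Hchord (INR nd * (K3 * N)) (thd 1%nat) (fC gam nd thd f)); try assumption.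
      apply holder_all_arcs; [lra|nra|exact Harc].
    + apply Rmult_le_compat_r; [left; apply Rpower_pos|]. fold n. nra.
Qed.

(** Gives the regularity of phi = u + J_f and, with zero coefficients, places a globally Hölder
    function in the piecewise space. *)
Lemma in_X_sum s s' (u v : C -> C) a : 0 < s -> s <= s' -> s' <= 1 -> in_H gam s' u ->
  eq_on (on_curve gam) v (fun t => (u t + jump_part gam nd thd a t)%C) ->
  in_X gam nd thd s v.
Proof.
  intros Hs Hss Hs1 Hu E. assert (HPI := PI_RGT_0). assert (HPI2 := PI2_1).
  assert (Huc := holder_pullback_continuous Hgam s' u ltac:(lra) Hu).
  destruct Hu as [M HM].
  destruct (gam_lipschitz Hgam) as [B [HB [HL _]]].
  destruct (arc_dist_power s Hs) as [K [HK Hdp]].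
  assert (Ha : exists A, 0 <= A /\ forall j, (1 <= j <= nd)%nat -> Cmod (a j) <= A).
  { exists (fold_right Rmax 0 (map (fun j => Cmod (a j)) (seq 1 nd))). split.
    - induction (seq 1 nd) as [|j l IH]; simpl; [lra|].
      eapply Rle_trans; [exact IH|apply Rmax_r].
    - intros j Hj. apply fold_right_Rmax_ge. apply (in_map (fun j => Cmod (a j))).
      apply in_seq. lia. }
  destruct Ha as [A [HA0 HA]].
  assert (Hv : forall j x, (1 <= j <= nd)%nat -> arc_l thd j < x <= arc_r nd thd j ->
            v (gam x) = (u (gam x) + arc_jump_part nd a j x)%C).
  { intros j x Hj Hx. rewrite (E _ (on_curve_gam gam x)). now rewrite (jump_part_arc a j). }
  (* The sum of [u] and the affine extension is continuous at every parameter, arc ends included, so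
     both lateral limits are read off it. *)
  assert (Hlip : forall j e x0, 0 < e -> exists d, 0 < d /\ forall y, Rabs (y - x0) < d ->
            Cmod ((u (gam y) + arc_jump_part nd a j y) - (u (gam x0) + arc_jump_part nd a j x0)) < e).
  { intros j e x0 He.
    destruct (proj1 (continuous_Cmod _ _) (Huc x0) (e / 2)) as [d [Hd Hy]]; [lra|].
    assert (Hn := pos_INR nd).
    assert (Hp : 0 < A * INR nd + 1) by nra.
    assert (Hq : 0 < e / 2 / (A * INR nd + 1)) by (apply Rdiv_lt_0_compat; lra).
    exists (Rmin d (e / 2 / (A * INR nd + 1))). split; [now apply Rmin_pos|].
    intros y Hyd. assert (H1 := Rlt_le_trans _ _ _ Hyd (Rmin_l _ _)).
    assert (H2 := Rlt_le_trans _ _ _ Hyd (Rmin_r _ _)).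
    rewrite Cminus_plus_plus.
    eapply Rle_lt_trans; [apply Cmod_triangle|].
    assert (H3 := Hy y H1). assert (H4 := arc_jump_part_lipschitz a A j y x0 HA).
    apply Rlt_div_r in H2; [|exact Hp].
    generalize (Rabs_pos (y - x0)). nra. }
  split.
  - intros j Hj. set (D := B * (2 * PI) + 1).
    assert (HD : 1 <= D) by (unfold D; nra).
    (* [D] pays for the lower exponent, [B] for passing from chord to parameter, the second summand
       for the affine part, and [K] for passing to the arc distance. *)
    exists ((Rabs M * D * Rpower B s + A * INR nd * (2 * PI)) * K).
    intros x y Hx Hy Hxy. rewrite (Hv j x), (Hv j y) by (auto; lra).
    assert (Hr : 0 < Rabs (x - y)) by (apply Rabs_pos_lt; lra).
    assert (Hr2 : Rabs (x - y) <= 2 * PI).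
    { generalize (arc_in_period Hdisc j Hj). intros. apply Rabs_le. lra. }
    rewrite Cminus_plus_plus.
    eapply Rle_trans; [apply Cmod_triangle|].
    destruct (Hdp j x y Hj ltac:(lra) ltac:(lra) Hxy) as [_ Hd].
    set (P := Rpower (Rabs (x - y)) s) in *.
    assert (HP : 0 < P) by apply Rpower_pos.
    assert (HBp := Rpower_pos B s). assert (HMp := Rabs_pos M). assert (Hn := pos_INR nd).
    assert (H1 : Cmod (u (gam x) - u (gam y)) <= Rabs M * D * Rpower B s * P).
    { destruct (classic (gam x = gam y)) as [Eg|Hne].
      - rewrite Eg. replace (u (gam y) - u (gam y))%C with (RtoC 0) by ring. rewrite Cmod_0.
        repeat apply Rmult_le_pos; lra.
      - assert (Hg : 0 < Cmod (gam x - gam y)).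
        { apply Cmod_gt_0. intros Eg. now apply Hne, Ceq_minus. }
        assert (Hgl := HL x y).
        assert (HgD : Cmod (gam x - gam y) <= D) by (unfold D; nra).
        eapply Rle_trans; [apply HM; auto using on_curve_gam|].
        apply Rle_trans with (Rabs M * Rpower (Cmod (gam x - gam y)) s').
        { apply Rmult_le_compat_r; [left; apply Rpower_pos|apply Rle_abs]. }
        rewrite !Rmult_assoc. apply Rmult_le_compat_l; [exact HMp|].
        eapply Rle_trans; [apply (Rpower_le_lower_exponent _ D s s'); lra|].
        apply Rmult_le_compat_l; [lra|]. unfold P.
        rewrite Rpower_mult_distr by lra. apply Rle_Rpower_l; lra. }
    assert (H2 := arc_jump_part_lipschitz a A j x y HA).
    assert (H3 := le_two_PI_Rpower s _ ltac:(lra) (conj Hr Hr2)). fold P in H3.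
    assert (H4 : A * INR nd * Rabs (x - y) <= A * INR nd * (2 * PI * P))
      by (apply Rmult_le_compat_l; [nra|exact H3]).
    assert (H5 : 0 <= Rabs M * D * Rpower B s + A * INR nd * (2 * PI)).
    { apply Rplus_le_le_0_compat; (apply Rmult_le_pos; [apply Rmult_le_pos|]); lra. }
    rewrite Rmult_assoc.
    apply Rle_trans with ((Rabs M * D * Rpower B s + A * INR nd * (2 * PI)) * P); [lra|].
    now apply Rmult_le_compat_l.
  - intros j Hj. exists (u (gam (thd j)) + arc_jump_part nd a j (thd j))%C.
    apply right_limit_iff. intros e He.
    assert (Hlen := arc_length_pos Hdisc j Hj). unfold arc_l in Hlen.
    destruct (Hlip j e (thd j) He) as [d [Hd Hy]].
    exists (Rmin d (arc_r nd thd j - thd j)). split; [apply Rmin_pos; lra|].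
    intros y Hyd. assert (H1 := Rmin_l d (arc_r nd thd j - thd j)).
    assert (H2 := Rmin_r d (arc_r nd thd j - thd j)).
    rewrite (Hv j y) by (auto; unfold arc_l; lra). apply Hy. rewrite Rabs_pos_eq; lra.
  - apply (left_limits_at_arc_ends Hgam Hdisc). intros j Hj.
    apply left_limit_iff. intros e He.
    assert (Hlen := arc_length_pos Hdisc j Hj).
    destruct (Hlip j e (arc_r nd thd j) He) as [d [Hd Hy]].
    exists (Rmin d (arc_r nd thd j - arc_l thd j)). split; [apply Rmin_pos; lra|].
    intros y Hyd. assert (H1 := Rmin_l d (arc_r nd thd j - arc_l thd j)).
    assert (H2 := Rmin_r d (arc_r nd thd j - arc_l thd j)).
    rewrite (Hv j y), (Hv j (arc_r nd thd j)) by (auto; lra). apply Hy.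
    rewrite Rabs_left; lra.
Qed.

End JumpPart.

(** * The reduced equation *)

Lemma in_H_lin gam s (a : C) v w : in_H gam s v -> in_H gam s w ->
  in_H gam s (fun t => a * v t + w t)%C.
Proof.
  intros [M HM] [M' HM']. exists (Cmod a * M + M'). intros t r Ht Hr Hne.
  rewrite Cminus_plus_plus. eapply Rle_trans; [apply Cmod_triangle|].
  replace (a * v t - a * v r)%C with (a * (v t - v r))%C by ring.
  rewrite Cmod_mult, Rmult_plus_distr_r, Rmult_assoc.
  apply Rplus_le_compat; [|now apply HM'].
  apply Rmult_le_compat_l; [apply Cmod_ge_0|now apply HM].
Qed.

Lemma in_H_ext gam s v w : eq_on (on_curve gam) v w -> in_H gam s v -> in_H gam s w.
Proof.
  intros E [M HM]. exists M. intros t r Ht Hr Hne.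
  rewrite <- (E t Ht), <- (E r Hr). now apply HM.
Qed.

Lemma in_H_continuous_on gam s v : 0 < s -> in_H gam s v -> continuous_on (on_curve gam) v.
Proof.
  intros Hs [M HM] t Ht. apply filterlim_Cmod. intros eps Heps.
  destruct (Rpower_small s (eps / (Rabs M + 1))) as [d [Hd Hsm]]; [exact Hs| |].
  { apply Rdiv_lt_0_compat; [lra|]. generalize (Rabs_pos M); lra. }
  change (locally (T := C_UniformSpace) t
            (fun y => on_curve gam y -> Cmod (v y - v t) < eps)).
  generalize (proj1 (filterlim_Cmod (F := locally (T := C_UniformSpace) t) (fun y : C => y) t)
                (filterlim_id _ _) d Hd).
  apply filter_imp. intros y Hy Hyc.
  destruct (classic (y = t)) as [->|Hne].
  { replace (v t - v t)%C with (RtoC 0) by ring. rewrite Cmod_0. lra. }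
  eapply Rle_lt_trans; [now apply HM|].
  assert (Hpos : 0 < Cmod (y - t)).
  { apply Cmod_gt_0. intros E. now apply Hne, Ceq_minus. }
  assert (HR := Hsm _ (conj Hpos Hy)). assert (HP := Rpower_pos (Cmod (y - t)) s).
  generalize (Rle_abs M), (Rabs_pos M). intros.
  apply Rlt_div_r in HR; [|lra]. nra.
Qed.

Lemma continuous_on_pullback gam v : is_contour gam -> continuous_on (on_curve gam) v ->
  pullback_continuous gam v.
Proof.
  intros Hgam Hv th P HP.
  change (locally th (fun x => P (v (gam x)))).
  apply (filter_imp (fun x => on_curve gam (gam x) -> P (v (gam x)))).
  - intros x Hx. exact (Hx (on_curve_gam gam x)).
  - exact (continuous_gam Hgam th _ (Hv _ (on_curve_gam gam th) P HP)).
Qed.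

Lemma pullback_bounded gam v : is_contour gam -> pullback_continuous gam v ->
  exists M, forall t, on_curve gam t -> Cmod (v t) <= M.
Proof. intros Hgam. apply (fs_bounded _ _ (pullback_function_space Hgam)). Qed.

(** Lowering the exponent from [mu] to [a] costs a factor of the size of the diameter of the
    curve. *)
Lemma Kop_in_H_lower {gam mu k} (Hgam : is_contour gam) (Hk : kernel_regular gam mu k) a :
  0 < a <= mu -> mu <= 1 -> exists c, 0 < c /\ forall v M, integrable gam v ->
  (forall t, on_curve gam t -> Cmod (v t) <= M) ->
  (forall t, on_curve gam t -> Cmod (Kop gam k v t) <= c * M) /\
  (forall t s, on_curve gam t -> on_curve gam s -> t <> s ->
     Cmod (Kop gam k v t - Kop gam k v s) <= c * M * Rpower (Cmod (t - s)) a).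
Proof.
  intros Ha Hmu. destruct (Kop_bounds Hgam Hk) as [c [Hc Hb]].
  destruct (gam_diameter Hgam) as [Dm [HDm HD]].
  exists (c * Dm). split; [nra|]. intros v M Hv HM.
  assert (HM0 : 0 <= M) by (eapply Rle_trans; [apply Cmod_ge_0|apply (HM _ (on_curve_gam gam 0))]).
  assert (HcM : 0 <= c * M) by nra.
  destruct (Hb v M Hv HM) as [H1 H2]. split.
  - intros t Ht. specialize (H1 t Ht). nra.
  - intros t s Ht Hs Hne. eapply Rle_trans; [now apply H2|].
    replace (c * Dm * M * Rpower (Cmod (t - s)) a)
      with (c * M * (Dm * Rpower (Cmod (t - s)) a)) by ring.
    apply Rmult_le_compat_l; [exact HcM|].
    apply Rpower_le_lower_exponent; try lra. split.
    + apply Cmod_gt_0. intros E. now apply Hne, Ceq_minus.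
    + destruct Ht as [x <-], Hs as [y <-]. apply HD.
Qed.

(** A globally continuous (Hölder) u admits two readings, hence the two equivalences; uniqueness is
    claimed in the larger class. *)
Theorem theorem6p1 (gam : R -> C) (nd : nat) (thd : nat -> R)
  (beta alpha mu : R) (k : C -> C -> C) (lam : C)
  (Hgam : is_contour gam) (Hdisc : is_disc nd thd)
  (Hbeta : 0 < beta) (Hba : beta < alpha) (Ham : alpha < mu) (Hmu : mu <= 1)
  (Hk : kernel_regular gam mu k)
  (Hker : forall v : C -> C, in_X gam nd thd beta v ->
     eq_on (on_curve gam) (Aop gam k lam v) (fun _ => RtoC 0) ->
     eq_on (on_curve gam) v (fun _ => RtoC 0)) :
  exists Cst : R, forall f : C -> C, in_X gam nd thd alpha f ->
    let Jf := Jpart gam nd thd f in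
    let g := gred gam nd thd k lam f in
    in_H gam alpha (fC gam nd thd f) /\
    (forall phi u : C -> C,
       eq_on (on_curve gam) phi (fun t => (u t + Jf t)%C) ->
       ((in_X gam nd thd beta phi /\
           eq_on (on_curve gam) (Aop gam k lam phi) f) <->
        (continuous_on (on_curve gam) u /\
           eq_on (on_curve gam) (Aop gam k lam u) g)) /\
       ((in_X gam nd thd beta phi /\
           eq_on (on_curve gam) (Aop gam k lam phi) f) <->
        ((exists s : R, 0 < s <= 1 /\ in_H gam s u) /\
           eq_on (on_curve gam) (Aop gam k lam u) g))) /\
    exists u : C -> C,
      (in_H gam alpha u /\ eq_on (on_curve gam) (Aop gam k lam u) g) /\
      (forall u' : C -> C, continuous_on (on_curve gam) u' ->
         eq_on (on_curve gam) (Aop gam k lam u') g ->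
         eq_on (on_curve gam) u' u) /\
      norm_H gam alpha u <= Cst * norm_X gam nd thd alpha f.
Proof.
  destruct (fC_bounds Hgam Hdisc alpha ltac:(lra)) as [K [HK HfC]].
  (* At the exponent beta, for the integrability of members of X_beta. *)
  destruct (fC_bounds Hgam Hdisc beta ltac:(lra)) as [Kb [HKb HfCb]].
  destruct (Kop_in_H_lower Hgam Hk alpha ltac:(lra) Hmu) as [c [Hc HKop]].
  assert (HKH : forall v, integrable gam v ->
            (exists M, forall t, on_curve gam t -> Cmod (v t) <= M) ->
            in_H gam alpha (Kop gam k v)).
  { intros v Hv [M HM]. exists (c * M). apply (HKop v M Hv HM). }
  assert (HKc : forall v, pullback_continuous gam v -> in_H gam alpha (Kop gam k v)).
  { intros v Hv. apply HKH; [now apply integrable_pullback_continuous|].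
    now apply pullback_bounded. }
  assert (HJint : forall f, integrable gam (Jpart gam nd thd f)).
  { intros f. apply (integrable_ext gam (jump_part gam nd thd (fun j => jump gam f (thd j)))).
    - intros t _. symmetry. apply Jpart_eq.
    - now apply integrable_jump_part. }
  assert (HXint : forall v, in_X gam nd thd beta v -> integrable gam v).
  { intros v Hv. destruct (HfCb v Hv) as [_ [_ H3]].
    apply (integrable_ext gam (fun t => 1 * fC gam nd thd v t + Jpart gam nd thd v t)%C).
    - intros t _. unfold fC. ring.
    - apply integrable_lin; [|apply HJint]. apply integrable_pullback_continuous.
      apply (holder_pullback_continuous Hgam beta); [exact Hbeta|].
      eexists; exact H3. }
  assert (Hinj : forall v, pullback_continuous gam v ->
     (forall t, on_curve gam t -> v t = (lam * Kop gam k v t)%C) ->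
     forall t, on_curve gam t -> v t = RtoC 0).
  { intros v Hv Heq. apply Hker.
    (* The equation itself puts [v] in H_alpha; zero coefficients express the absence of jumps. *)
    - apply (in_X_sum Hgam Hdisc beta alpha v v (fun _ => RtoC 0)); try lra.
      + apply (in_H_ext gam alpha (fun t => lam * Kop gam k v t + (fun _ => RtoC 0) t)%C).
        * intros t Ht. rewrite (Heq t Ht). ring.
        * apply in_H_lin; [now apply HKc|]. exists 0. intros.
          replace (0 - 0)%C with (RtoC 0) by ring. rewrite Cmod_0. lra.
      + intros t _. unfold jump_part.
        rewrite (lsum_ext _ _ (fun _ => RtoC 0)) by (intros; ring). rewrite lsum_zero. ring.
    - intros t Ht. unfold Aop. rewrite (Heq t Ht) at 1. ring. }
  assert (Hmu0 : 0 < mu) by lra.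
  destruct (fredholm_contour Hgam Hmu0 Hk lam Hinj) as [C1 HC1].
  set (la := Cmod lam). assert (Hla : 0 <= la) by apply Cmod_ge_0.
  set (Kg := K + la * (c * K)).
  (* The sup norm of u, then the contributions of f_C, lam K J_f and lam K u to its seminorm. *)
  exists (C1 * Kg + (K + la * (c * K) + la * (c * (C1 * Kg)))).
  intros f Hf Jf g. set (N := norm_X gam nd thd alpha f).
  destruct (HfC f Hf) as [HJb [HfCs HfCh]]. fold Jf in HJb. fold N in HJb, HfCs, HfCh.
  assert (HfCH : in_H gam alpha (fC gam nd thd f)) by (eexists; exact HfCh).
  assert (HJf : integrable gam Jf) by apply HJint.
  assert (HgH : in_H gam alpha g).
  { apply (in_H_ext gam alpha (fun t => lam * Kop gam k Jf t + fC gam nd thd f t)%C).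
    - intros t _. unfold g, gred. fold Jf. ring.
    - apply in_H_lin; [|exact HfCH]. apply HKH; [exact HJf|]. eauto. }
  assert (Hsolution : forall u, pullback_continuous gam u ->
            eq_on (on_curve gam) (Aop gam k lam u) g -> in_H gam alpha u).
  { intros u Hu Heq. apply (in_H_ext gam alpha (fun t => lam * Kop gam k u t + g t)%C).
    - intros t Ht. rewrite <- (Heq t Ht). unfold Aop. ring.
    - apply in_H_lin; [now apply HKc|exact HgH]. }
  assert (Hforth : forall phi u, eq_on (on_curve gam) phi (fun t => (u t + Jf t)%C) ->
     in_X gam nd thd beta phi -> eq_on (on_curve gam) (Aop gam k lam phi) f ->
     in_H gam alpha u /\ eq_on (on_curve gam) (Aop gam k lam u) g).
  { intros phi u E Hphi Heq. assert (Hpi := HXint phi Hphi).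
    (* Cancelling J_f leaves u = f_C + lam K phi, which yields the regularity of u with no
       continuity assumed. *)
    assert (Hut : forall t, on_curve gam t ->
              u t = (lam * Kop gam k phi t + fC gam nd thd f t)%C).
    { intros t Ht. unfold fC. fold Jf. rewrite <- (Heq t Ht). unfold Aop.
      rewrite (E t Ht). ring. }
    split.
    - apply (in_H_ext gam alpha (fun t => lam * Kop gam k phi t + fC gam nd thd f t)%C).
      + intros t Ht. now rewrite (Hut t Ht).
      + apply in_H_lin; [|exact HfCH]. apply HKH; [exact Hpi|].
        eexists. exact (norm_X_sup Hgam Hdisc Hbeta Hphi).
    - intros t Ht. unfold Aop.
      rewrite (Kop_ext u (fun s => -1 * Jf s + phi s)%C)
        by (intros s Hs; rewrite (E s Hs); ring).
      rewrite (Kop_lin Hgam Hk) by assumption.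
      rewrite (Hut t Ht). unfold g, gred. fold Jf. ring. }
  assert (Hback : forall phi u, eq_on (on_curve gam) phi (fun t => (u t + Jf t)%C) ->
     pullback_continuous gam u -> eq_on (on_curve gam) (Aop gam k lam u) g ->
     in_X gam nd thd beta phi /\ eq_on (on_curve gam) (Aop gam k lam phi) f).
  { intros phi u E Hu Heq. split.
    - apply (in_X_sum Hgam Hdisc beta alpha u phi (fun j => jump gam f (thd j)));
        try lra; [now apply Hsolution|].
      intros t Ht. rewrite <- Jpart_eq. now apply E.
    - intros t Ht. unfold Aop.
      rewrite (Kop_ext phi (fun s => 1 * u s + Jf s)%C)
        by (intros s Hs; rewrite (E s Hs); ring).
      rewrite (Kop_lin Hgam Hk) by (auto using integrable_pullback_continuous).
      rewrite (E t Ht).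
      assert (H := Heq t Ht). unfold Aop, g, gred, fC in H. fold Jf in H.
      apply Ceq_minus in H. apply Ceq_minus. rewrite <- H. ring. }
  split; [exact HfCH|]. split.
  { intros phi u E. split; split.
    - intros [Hphi Heq]. destruct (Hforth phi u E Hphi Heq) as [H1 H2].
      split; [|exact H2]. apply (in_H_continuous_on gam alpha); [lra|exact H1].
    - intros [Hu Heq]. apply (Hback phi u); auto. now apply continuous_on_pullback.
    - intros [Hphi Heq]. destruct (Hforth phi u E Hphi Heq) as [H1 H2].
      split; [|exact H2]. exists alpha. split; [lra|exact H1].
    - intros [[s [Hs Hu]] Heq]. apply (Hback phi u); auto.
      now apply (holder_pullback_continuous Hgam s). }
  assert (HN : 0 <= N) by (apply (norm_X_nonneg Hgam Hdisc); [lra|exact Hf]).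
  destruct (HKop Jf (K * N) HJf HJb) as [HKJ1 HKJ2].
  assert (Hgb : forall t, on_curve gam t -> Cmod (g t) <= Kg * N).
  { intros t Ht. unfold g, gred. fold Jf. eapply Rle_trans; [apply Cmod_triangle|].
    rewrite Cmod_mult. fold la.
    assert (la * Cmod (Kop gam k Jf t) <= la * (c * (K * N)))
      by (apply Rmult_le_compat_l; auto).
    specialize (HfCs t Ht). unfold Kg. lra. }
  destruct (HC1 g (Kg * N)) as [u [Hu [Heq Hub]]].
  { apply (holder_pullback_continuous Hgam alpha); [lra|exact HgH]. }
  { exact Hgb. }
  assert (HAu : eq_on (on_curve gam) (Aop gam k lam u) g).
  { intros t Ht. unfold Aop. rewrite (Heq t Ht) at 1. ring. }
  exists u. split; [split; [now apply Hsolution|exact HAu]|]. split.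
  - intros u' Hu' Heq' t Ht. apply Ceq_minus.
    assert (Hu'c := continuous_on_pullback gam u' Hgam Hu').
    (* The difference of two solutions is a continuous null vector. *)
    revert t Ht. apply (Hinj (fun t => u' t - u t)%C).
    + apply (fs_minus (pullback_function_space Hgam)); assumption.
    + intros t Ht.
      rewrite (Kop_ext (fun s => u' s - u s)%C (fun s => -1 * u s + u' s)%C)
        by (intros s _; ring).
      rewrite (Kop_lin Hgam Hk) by (auto using integrable_pullback_continuous).
      assert (H := Heq' t Ht). rewrite <- (HAu t Ht) in H. unfold Aop in H.
      apply Ceq_minus in H. apply Ceq_minus. rewrite <- H. ring.
  - destruct (HKop u (C1 * (Kg * N)) (integrable_pullback_continuous gam u Hu) Hub)
      as [HKu1 HKu2].
    assert (Hu0 : 0 <= C1 * (Kg * N))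
      by (eapply Rle_trans; [apply Cmod_ge_0|apply (Hub _ (on_curve_gam gam 0))]).
    rewrite Rmult_plus_distr_r. unfold norm_H. apply Rplus_le_compat.
    + apply rsup_le; [lra|]. intros r [t [Ht ->]]. rewrite Rmult_assoc. now apply Hub.
    + replace ((K + la * (c * K) + la * (c * (C1 * Kg))) * N)
        with (K * N + la * (c * (K * N)) + la * (c * (C1 * (Kg * N)))) by ring.
      assert (Hpos : 0 <= K * N) by nra.
      apply rsup_le.
      { assert (0 <= la * (c * (K * N))) by (repeat apply Rmult_le_pos; lra).
        assert (0 <= la * (c * (C1 * (Kg * N)))) by (apply Rmult_le_pos; nra).
        lra. }
      intros r [t [t' [Ht [Ht' [Hne ->]]]]].
      apply Rle_div_l; [apply Rpower_pos|]. set (P := Rpower (Cmod (t - t')) alpha).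
      (* Each of the three differences has a Hölder bound in terms of [N]; for lam K u only the sup
         bound of u enters. *)
      replace (u t - u t')%C with
        (fC gam nd thd f t - fC gam nd thd f t'
         + (lam * (Kop gam k Jf t - Kop gam k Jf t') + lam * (Kop gam k u t - Kop gam k u t')))%C.
      2:{ rewrite (Heq t Ht), (Heq t' Ht'). unfold g, gred. fold Jf. ring. }
      eapply Rle_trans; [apply Cmod_triangle|].
      specialize (HfCh t t' Ht Ht' Hne).
      assert (Hsum := Cmod_triangle (lam * (Kop gam k Jf t - Kop gam k Jf t'))
                        (lam * (Kop gam k u t - Kop gam k u t'))).
      rewrite !Cmod_mult in Hsum. fold la in Hsum.
      assert (la * Cmod (Kop gam k Jf t - Kop gam k Jf t') <= la * (c * (K * N) * P))
        by (apply Rmult_le_compat_l; auto).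
      assert (la * Cmod (Kop gam k u t - Kop gam k u t') <= la * (c * (C1 * (Kg * N)) * P))
        by (apply Rmult_le_compat_l; auto).
      fold P in HfCh. lra.
Qed.
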